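(* Let $K$ be an algebraically closed field, let $\Omega$ be a signature, let $G$ be any semigroup, and let $A$ and $B$ be two finite-dimensional $G$-graded $\Omega$-algebras over $K$ which are prime as $G$-graded $\Omega$-algebras. Then $A$ is isomorphic to $B$ as a $G$-graded $\Omega$-algebra if and only if $A$ and $B$ satisfy the same $G$-graded polynomial identities as $G$-graded $\Omega$-algebras.
   Context: A signature is a set $\Omega=\bigcup_{m\ge 0}\Omega_m$ (disjoint union); it is assumed throughout that $\bigcup_{m\ge 2}\Omega_m\neq\emptyset$. An $\Omega$-algebra over $K$ is a $K$-vector space $A$ such that every $\omega\in\Omega_m$ defines an $m$-linear operation $\omega:A\otimes\cdots\otimes A\to A$ ($m$ factors); for $m=0$ this is a distinguished element of $A$. Homomorphisms are linear maps commuting with all operations. An ideal is a subspace $I$ with $\omega(a_1,\ldots,a_m)\in I$ whenever $m\ge1$, $\omega\in\Omega_m$ and some $a_i\in I$. A $G$-graded $\Omega$-algebra is an $\Omega$-algebra $A$ with a vector space decomposition $A=\bigoplus_{g\in G}A_g$ such that every operation is $G$-homogeneous: for $m\ge 1$, $\omega\in\Omega_m$, one has $\omega(A_{g_1},\ldots,A_{g_m})\subset A_{g_1\cdots g_m}$ for all $g_1,\ldots,g_m\in G$; for $0$-ary operations, a degree $\deg_G\omega\in G$ is fixed once and for all for each $\omega\in\Omega_0$, and the element of $A$ given by $\omega$ is required to lie in $A_{\deg_G\omega}$. Homomorphisms of $G$-graded $\Omega$-algebras are homomorphisms of $\Omega$-algebras $\varphi:A\to B$ with $\varphi(A_g)\subset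 B_g$ for all $g$; isomorphisms are the bijective ones. A graded ideal is an ideal $I$ with $I=\bigoplus_g (I\cap A_g)$. $A$ is prime as a $G$-graded $\Omega$-algebra if $A\ne0$ and for any two nonzero graded ideals $I,J$ of $A$ there are $m\ge 2$, $\omega\in\Omega_m$, indices $i\ne j$ in $\{1,\ldots,m\}$ and elements $a_1,\ldots,a_m\in A$ with $a_i\in I$, $a_j\in J$ and $\omega(a_1,\ldots,a_m)\neq 0$. Let $X$ be a countably infinite set and $X^G=\{x^{(g)}\mid x\in X,\ g\in G\}$. Let $F_\Omega(X^G)$ be the free $\Omega$-algebra on $X^G$ (the vector space with basis all $\Omega$-monomials in $X^G$). An element $f\in F_\Omega(X^G)$ is a $G$-graded polynomial identity of $A$ if it is mapped to $0$ by every $\Omega$-algebra homomorphism $F_\Omega(X^G)\to A$ sending each $x^{(g)}$ into $A_g$. *)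

(* Defs.v *)
From HB Require Import structures.
From mathcomp Require Import all_boot all_order all_algebra.
From mathcomp Require Import finmap.
From mathcomp.multinomials Require Import monalg.

Set Implicit Arguments.
Unset Strict Implicit.
Unset Printing Implicit Defensive.

Import GRing.Theory.
Local Open Scope ring_scope.

(* [Omega m] is the set of m-ary operation symbols; indexing by the arity
   makes the union over m disjoint. *)
Definition signature := nat -> choiceType.

Definition ffun_upd (m : nat) (T : Type) (a : {ffun 'I_m -> T}) (i : 'I_m)
    (x : T) : {ffun 'I_m -> T} :=
  [ffun j => if j == i then x else a j].

(* For m = 0 this holds trivially, and f is just its value at the empty tuple. *)
Definition multilinear (K : fieldType) (A B : lmodType K) (m : nat)
    (f : {ffun 'I_m -> A} -> B) : Prop :=
  forall (a : {ffun 'I_m -> A}) (i : 'I_m), linear (fun x => f (ffun_upd a i x)).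

Record omega_str (K : fieldType) (Omega : signature) (A : lmodType K) :=
  OmegaStr {
    omega_op : forall m : nat, Omega m -> {ffun 'I_m -> A} -> A;
    omega_opP : forall (m : nat) (w : Omega m), multilinear (omega_op w)
  }.
Arguments omega_op {K Omega A} o {m} w a.

Definition omega_hom (K : fieldType) (Omega : signature) (A B : lmodType K)
    (sA : omega_str Omega A) (sB : omega_str Omega B)
    (phi : {linear A -> B}) : Prop :=
  forall (m : nat) (w : Omega m) (a : {ffun 'I_m -> A}),
    phi (omega_op sA w a) = omega_op sB w [ffun i => phi (a i)].

Section Graded.
Variables (K : fieldType) (Omega : signature) (G : semigroupType).

(* V is the direct sum of the family W, which is allowed to be infinite:
   each v in V is in exactly one way a finitely supported sum of elements
   of the W g. *)
Definition direct_decomposition (A : vectType K) (V : {vspace A})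
    (W : G -> {vspace A}) : Prop :=
  (forall g, (W g <= V)%VS) /\
  (forall v, v \in V ->
     exists! c : {fsfun G -> A with 0},
       (forall g, c g \in W g) /\ v = \sum_(g <- finsupp c) c g).

(* g_1 * ... * g_m for m = n + 1 >= 1; no unit is available in G. *)
Definition semigroup_prod (n : nat) (g : 'I_n.+1 -> G) : G :=
  foldl (fun x y => (x * y)%g) (g ord0) [seq g (lift ord0 i) | i <- enum 'I_n].

(* Finite-dimensional G-graded Omega-algebras; [deg0] gives the prescribed
   degrees of the 0-ary operations. *)
Record fd_graded_alg (deg0 : Omega 0 -> G) := FdGradedAlg {
  ga_sort :> vectType K;
  ga_str : omega_str Omega ga_sort;
  ga_comp : G -> {vspace ga_sort};
  ga_direct : direct_decomposition fullv ga_comp;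
  ga_homog : forall (n : nat) (w : Omega n.+1) (g : 'I_n.+1 -> G)
      (a : {ffun 'I_n.+1 -> ga_sort}),
    (forall i, a i \in ga_comp (g i)) ->
    omega_op ga_str w a \in ga_comp (semigroup_prod g);
  ga_homog0 : forall (w : Omega 0) (a : {ffun 'I_0 -> ga_sort}),
    omega_op ga_str w a \in ga_comp (deg0 w)
}.

Variable deg0 : Omega 0 -> G.
Implicit Types A B : fd_graded_alg deg0.

Definition graded_isomorphic A B : Prop :=
  exists phi : {linear A -> B},
    [/\ omega_hom (ga_str A) (ga_str B) phi,
        forall (g : G) (a : A), a \in ga_comp A g -> phi a \in ga_comp B g
      & bijective phi].

Definition is_ideal A (I : {vspace A}) : Prop :=
  forall (m : nat) (w : Omega m) (a : {ffun 'I_m -> A}) (i : 'I_m),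
    a i \in I -> omega_op (ga_str A) w a \in I.

Definition is_graded_ideal A (I : {vspace A}) : Prop :=
  is_ideal I /\ direct_decomposition I (fun g => (I :&: ga_comp A g)%VS).

Definition graded_prime A : Prop :=
  (exists a : A, a != 0) /\
  forall I J : {vspace A},
    is_graded_ideal I -> is_graded_ideal J -> I != 0%VS -> J != 0%VS ->
    exists (m : nat) (w : Omega m) (i j : 'I_m) (a : {ffun 'I_m -> A}),
      [/\ (2 <= m)%N, i != j, a i \in I, a j \in J
        & omega_op (ga_str A) w a != 0].

End Graded.

Section Monomials.
Variables (Omega : signature) (X : choiceType).

Unset Elimination Schemes.
Inductive monomial :=
  | MVar of X
  | MOp m of Omega m & {ffun 'I_m -> monomial}.
Set Elimination Schemes.

Fixpoint monomial_ind (P : monomial -> Prop)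
    (Pvar : forall x, P (MVar x))
    (Pop : forall m (w : Omega m) (a : {ffun 'I_m -> monomial}),
       (forall i, P (a i)) -> P (MOp w a)) (u : monomial) : P u :=
  match u with
  | MVar x => Pvar x
  | MOp m w a => Pop m w a (fun i => monomial_ind Pvar Pop (a i))
  end.

Fixpoint monomial_encode (u : monomial) :
    GenTree.tree (X + {m : nat & Omega m}) :=
  match u with
  | MVar x => GenTree.Leaf (inl x)
  | MOp m w a =>
      GenTree.Node 0 (GenTree.Leaf (inr (Tagged (fun m => Omega m) w)) ::
                      [seq monomial_encode (a i) | i <- enum 'I_m])
  end.

Fixpoint monomial_decode (t : GenTree.tree (X + {m : nat & Omega m})) :
    option monomial :=
  match t with
  | GenTree.Leaf (inl x) => Some (MVar x)
  | GenTree.Node _ (GenTree.Leaf (inr (existT m w)) :: ts) =>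
      if insub (pmap monomial_decode ts) is Some a
      then Some (MOp w [ffun i => tnth (a : m.-tuple monomial) i]) else None
  | _ => None
  end.

Lemma monomial_encodeK : pcancel monomial_encode monomial_decode.
Proof.
elim=> //= m w a IHa.
have -> : pmap monomial_decode [seq monomial_encode (a i) | i <- enum 'I_m] =
    [seq a i | i <- enum 'I_m].
  by elim: (enum _) => //= i s ->; rewrite IHa.
have sz : size [seq a i | i <- enum 'I_m] == m by rewrite size_map size_enum_ord.
rewrite insubT /=; congr (Some (MOp _ _)); apply/ffunP => i.
by rewrite ffunE (tnth_nth (a i)) /= (nth_map i) ?size_enum_ord ?nth_ord_enum.
Qed.

HB.instance Definition _ := Choice.copy monomial (pcan_type monomial_encodeK).

End Monomials.

Section FreeAlgebra.
Variables (K : fieldType) (Omega : signature) (X : choiceType).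
Local Notation M := (monomial Omega X).

Definition free_alg : lmodType K := {malg K[M]}.

(* The multilinear extension of (u_1, ..., u_m) |-> w(u_1, ..., u_m) from
   monomials to their finite linear combinations. *)
Definition free_op (m : nat) (w : Omega m) (f : {ffun 'I_m -> free_alg}) :
    free_alg :=
  \sum_(t : {ffun 'I_m -> (\bigcup_(i <- enum 'I_m) msupp (f i))%fset})
     (\prod_(i : 'I_m) (f i)@_(val (t i))) *:
     << MOp w [ffun i => val (t i)] >>.

Lemma free_opEw (m : nat) (w : Omega m) (f : {ffun 'I_m -> free_alg})
    (d : {fset M}) :
  (forall i, (msupp (f i) `<=` d)%fset) ->
  free_op w f =
  \sum_(t : {ffun 'I_m -> d})
     (\prod_(i : 'I_m) (f i)@_(val (t i))) *:
     << MOp w [ffun i => val (t i)] >>.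
Proof.
rewrite /free_op => sfd; set e := (\bigcup_(i <- enum 'I_m) _)%fset.
have sed : (e `<=` d)%fset by apply/bigfcupsP => i _ _; apply: sfd.
pose h (t : {ffun 'I_m -> e}) : {ffun 'I_m -> d} := [ffun i => fincl sed (t i)].
have hinj : injective h.
  move=> t t' /ffunP tt'; apply/ffunP => i; apply/val_inj.
  by have := congr1 val (tt' i); rewrite !ffunE.
rewrite [RHS](bigID (mem (h @: setT))) /= [X in _ = _ + X]big1 ?addr0; last first.
  move=> t; apply: contraNeq => nz0.
  have supp i : val (t i) \in e.
    apply/bigfcupP; exists i; first by rewrite mem_enum.
    rewrite -mcoeff_neq0; apply: contraNneq nz0 => fi0.
    by rewrite (bigD1 i) //= fi0 mul0r scale0r.
  apply/imsetP; exists [ffun i => [` supp i]%fset] => //.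
  by apply/ffunP => i; apply/val_inj; rewrite !ffunE.
rewrite big_imset /=; last by move=> t t' _ _; apply: hinj.
apply: eq_big => [t|t _]; first by rewrite inE.
congr (_ *: << MOp w _ >>); last by apply/ffunP => i; rewrite !ffunE.
by apply: eq_bigr => i _; rewrite ffunE.
Qed.

Lemma free_opU (m : nat) (w : Omega m) (u : {ffun 'I_m -> M}) :
  free_op w [ffun i => << u i >>] = << MOp w u >>.
Proof.
pose d := [fset x in codom u]%fset.
have ud i : u i \in d by rewrite !inE codom_f.
rewrite (free_opEw w (d := d)); last first.
  move=> i; rewrite ffunE; apply: fsubset_trans (msuppU_le) _.
  by rewrite fsub1set ud.
rewrite (bigD1 [ffun i => [` ud i]%fset]) //= [X in _ + X]big1 ?addr0 => [|t].
  rewrite big1 ?scale1r => [|i _]; last by rewrite !ffunE /= mcoeffUU.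
  by congr (<< MOp w _ >>); apply/ffunP => i; rewrite !ffunE.
apply: contraNeq => nz; apply/eqP/ffunP => i; rewrite ffunE; apply/val_inj => /=.
apply/eqP; apply: contraNT nz => ti.
by rewrite (bigD1 i) //= ffunE mcoeffU [u i == _]eq_sym (negPf ti) mul0r scale0r.
Qed.

Lemma free_op_multilinear (m : nat) (w : Omega m) : multilinear (free_op w).
Proof.
move=> a i c x y.
pose d := (msupp x `|` msupp y `|` \bigcup_(j <- enum 'I_m) msupp (a j))%fset.
have sub z : (msupp z `<=` (msupp x `|` msupp y))%fset ->
    forall j, (msupp (ffun_upd a i z j) `<=` d)%fset.
  move=> sz j; rewrite ffunE; case: eqP => _.
    exact: fsubset_trans sz (fsubsetUl _ _).
  by apply/fsubsetP => u uj; rewrite inE; apply/orP; right;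
     apply/bigfcupP; exists j; rewrite ?mem_enum.
have sxy : (msupp (c *: x + y) `<=` (msupp x `|` msupp y))%fset.
  apply: fsubset_trans (msuppD_le _ _) _.
  by apply: fsetUSS => //; apply: msuppZ_le.
rewrite !(free_opEw w (d := d)); try exact: sub; last 2 first.
- exact/sub/fsubsetUr.
- exact/sub/fsubsetUl.
have E z (t : {ffun 'I_m -> d}) :
    \prod_j (ffun_upd a i z j)@_(val (t j)) =
    z@_(val (t i)) * \prod_(j | j != i) (a j)@_(val (t j)).
  rewrite (bigD1 i) //= ffunE eqxx; congr (_ * _).
  by apply: eq_bigr => j /negPf ji; rewrite ffunE ji.
rewrite scaler_sumr -big_split /=; apply: eq_bigr => t _.
by rewrite !E mcoeffD mcoeffZ mulrDl scalerDl -mulrA scalerA.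
Qed.

Definition free_str : omega_str Omega free_alg := OmegaStr free_op_multilinear.

End FreeAlgebra.

Section Identities.
Variables (K : fieldType) (Omega : signature) (G : semigroupType).
Variable deg0 : Omega 0 -> G.

(* The countable set of letters is nat; the pair (k, g) is the variable
   x_k^(g). *)
Definition graded_poly : lmodType K := free_alg K Omega (nat * G)%type.

Definition graded_var (k : nat) (g : G) : graded_poly :=
  << MVar Omega (k, g) >>.

Definition graded_identity (A : fd_graded_alg K deg0) (f : graded_poly) :
    Prop :=
  forall phi : {linear graded_poly -> A},
    omega_hom (free_str K Omega (nat * G)%type) (ga_str A) phi ->
    (forall (k : nat) (g : G), phi (graded_var k g) \in ga_comp A g) ->
    phi f = 0.

End Identities.

(* Main.v *)
From Stdlib Require List.
From HB Require Import structures.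
Require Import Defs.
From mathcomp Require Import all_boot all_order all_fingroup all_algebra.
From mathcomp Require Import finmap boolp closed_field.
From mathcomp.multinomials Require monalg mpoly.

Set Implicit Arguments.
Unset Strict Implicit.
Unset Printing Implicit Defensive.

Import GRing.Theory.
Local Open Scope ring_scope.

(** An isomorphism preserves identities. For the converse, the identities of a
    prime algebra turn out to determine the Zariski closure of the set of all
    systems of structure constants of the algebra in homogeneous bases. That
    set contains a nonempty open subset of its closure, so for two algebras
    with the same closure the two sets meet: the algebras have equal structure
    constants in suitable bases, and are isomorphic.

    The passage from identities to structure constants rests on primeness. Let
    M be a minimal nonzero graded ideal of A. By primeness M lies in every
    nonzero graded ideal, and some operation is not identically zero when two
    of its arguments are taken in M. As K is algebraically closed, an argument in the
    manner of the theorem of Burnside shows that for every u in M and every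
    functional l on A the operator v |-> l(v) u is a combination of compositions
    of operations with all arguments but one fixed ([rank_one_dense],
    [minimal_ideal]). Combining such operators by an operation that does not
    vanish on M, one obtains polynomials, multilinear in v_1, ..., v_r, whose
    value is l_1(v_1) ... l_r(v_r) w with a fixed w <> 0 ([product_poly]).

    For homogeneous x_1, ..., x_n of the degrees of a homogeneous basis, consider
    the determinant of the coordinates of x, and those of the families where one
    x_k is replaced by the value of an operation at some of the x_i. By the rule
    of Cramer the quotients of the latter by the former are the structure
    constants with respect to x. A homogeneous form P in these determinants is a
    combination of products of coordinates, so P w is the value of a polynomial
    that alternates in blocks of n arguments. On B alternation alone forces the
    value to be P, computed with the determinants of B, times a fixed vector.
    Hence a form that does not vanish identically on A does not vanish
    identically on B ([transfer_det]); applied to the first determinant alone,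
    this shows that the dimensions of the components agree ([transfer_free]).

    Multiplied by scalars, the vectors of these determinants fill a cone, and the
    cones of A and B have the same closure ([transfer_cone]). For finitely many
    structure constants they are images of affine spaces under polynomial maps,
    therefore constructible by quantifier elimination, and since affine spaces
    are irreducible they contain nonempty open subsets of their closure
    ([image_contains_open]); so they have a common point where the determinant
    of x is not zero ([common_value]). The basis theorem of Hilbert reduces an
    infinite signature to finitely many structure constants ([zeros_finite]). *)

(** * Multilinear maps and alternating sums *)

Section Multilinear.
Variables (K : fieldType) (A B : lmodType K) (m : nat).
Variable f : {ffun 'I_m -> A} -> B.
Hypothesis fml : multilinear f.
Implicit Types (a : {ffun 'I_m -> A}) (i : 'I_m).

Lemma ffun_updE (T : Type) (u : {ffun 'I_m -> T}) i x j :
  ffun_upd u i x j = if j == i then x else u j.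
Proof. by rewrite ffunE. Qed.

Lemma ffun_upd_id (T : Type) (u : {ffun 'I_m -> T}) i : ffun_upd u i (u i) = u.
Proof. by apply/ffunP => j; rewrite ffunE; case: eqP => [->|]. Qed.

Lemma multilinearD a i x y :
  f (ffun_upd a i (x + y)) = f (ffun_upd a i x) + f (ffun_upd a i y).
Proof. by have := fml a i 1 x y; rewrite !scale1r. Qed.

Lemma multilinear0 a i : f (ffun_upd a i 0) = 0.
Proof.
apply: (@addrI _ (f (ffun_upd a i 0))).
by rewrite -multilinearD !addr0.
Qed.

Lemma multilinearZ a i c x :
  f (ffun_upd a i (c *: x)) = c *: f (ffun_upd a i x).
Proof. by have := fml a i c x 0; rewrite !addr0 multilinear0 addr0. Qed.

Lemma multilinear_sum a i (T : Type) (r : seq T) (P : pred T) (F : T -> A) :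
  f (ffun_upd a i (\sum_(j <- r | P j) F j)) =
  \sum_(j <- r | P j) f (ffun_upd a i (F j)).
Proof.
by apply: (big_morph (fun x => f (ffun_upd a i x)) (multilinearD a i));
   apply: multilinear0.
Qed.

(** The values of a multilinear map on arbitrary arguments are sums of its
    values on the summands of the arguments: whatever holds for the latter and
    is stable under sums holds for the former. *)
Lemma multilinear_ind (S : 'I_m -> A -> Prop) (Q : B -> Prop) a :
  Q 0 -> (forall x y, Q x -> Q y -> Q (x + y)) ->
  (forall a', (forall i, S i (a' i)) -> Q (f a')) ->
  (forall i, exists2 s : seq A,
     (forall x, x \in s -> S i x) & a i = \sum_(x <- s) x) ->
  Q (f a).
Proof.
move=> Q0 QD QS Sa.
(* The arguments of index less than k are still arbitrary. *)
suff: forall k a', (k <= m)%N -> (forall i, (i < k)%N -> a' i = a i) ->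
    (forall i, (k <= i)%N -> S i (a' i)) -> Q (f a').
  by move=> /(_ m a (leqnn m)); apply => // i; rewrite leqNgt ltn_ord.
elim=> [|k IHk] a' km a'a Sa'; first by apply: QS => i; apply: Sa'.
pose i0 := Ordinal km; have [s sS as_] := Sa i0.
rewrite -(ffun_upd_id a' i0) a'a //= as_ multilinear_sum.
rewrite big_seq; apply: big_ind => // x xs; apply: IHk.
- exact: ltnW.
- move=> i ik; rewrite ffun_updE -val_eqE /= ltn_eqF //.
  by apply: a'a; apply: ltnW.
move=> i; rewrite ffun_updE; case: eqP => [-> _|ne]; first exact: sS.
rewrite leq_eqVlt => /orP[/eqP ki|/Sa' //].
by case: ne; apply: val_inj.
Qed.

Lemma multilinear_expand (J : finType) (F : 'I_m -> J -> A)
    (p0 : {ffun 'I_m -> J}) :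
  f [ffun i => \sum_j F i j] =
  \sum_(p : {ffun 'I_m -> J}) f [ffun i => F i (p i)].
Proof.
(* The sums are expanded at the indices in r; elsewhere the choice is p. *)
have main : forall r, uniq r -> forall p : {ffun 'I_m -> J},
    f [ffun i => if i \in r then \sum_j F i j else F i (p i)] =
    \sum_(p' : {ffun 'I_m -> J} | [forall i, (i \notin r) ==> (p' i == p i)])
      f [ffun i => F i (p' i)].
  elim=> [|i r IHr] /=.
    move=> _ p; rewrite (big_pred1 p) => [|p' /=].
      by congr (f _); apply/ffunP => i; rewrite !ffunE.
    apply/forallP/eqP => [pp'|-> i]; last by rewrite eqxx.
    by apply/ffunP => i; apply/eqP; have := pp' i.
  case/andP=> ir ur p.
  rewrite (partition_big (fun p' : {ffun 'I_m -> J} => p' i) predT) //=.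
  pose a := [ffun k => if k \in r then \sum_j F k j else F k (p k)].
  transitivity (f (ffun_upd a i (\sum_j F i j))).
    congr (f _); apply/ffunP => k; rewrite !ffunE inE.
    by case: eqP => [->|].
  rewrite multilinear_sum; apply: eq_bigr => j _.
  transitivity (f [ffun k => if k \in r then \sum_j F k j
                             else F k (ffun_upd p i j k)]).
    congr (f _); apply/ffunP => k; rewrite !ffunE.
    by case: eqP => [->|//]; rewrite (negPf ir).
  rewrite IHr //; apply: eq_bigl => p'.
  apply/forallP/andP => [h|[/forallP h /eqP p'i] k].
    split; last by have := h i; rewrite ir ffunE eqxx.
    apply/forallP => k; have := h k; rewrite ffunE inE negb_or.
    by have [->|//] := eqVneq k i.
  have := h k; rewrite ffunE inE negb_or; have [->|//] := eqVneq k i.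
  by rewrite p'i eqxx implybT.
have := main (enum 'I_m) (enum_uniq _) p0.
rewrite [X in f X](_ : _ = [ffun i => \sum_j F i j]); last first.
  by apply/ffunP => i; rewrite !ffunE mem_enum.
by move->; apply: eq_bigl => p; apply/forallP => i; rewrite mem_enum.
Qed.

Lemma multilinear_scale (c : 'I_m -> K) a :
  f [ffun i => c i *: a i] = (\prod_i c i) *: f a.
Proof.
have main : forall r, uniq r ->
    f [ffun i => if i \in r then c i *: a i else a i] =
    (\prod_(i <- r) c i) *: f a.
  elim=> [_|i r IHr /=].
    by rewrite big_nil scale1r; congr (f _); apply/ffunP => i; rewrite !ffunE.
  case/andP=> ir ur; rewrite big_cons -scalerA -IHr //.
  set b := [ffun k => if k \in r then _ else _].
  have -> : b = ffun_upd b i (a i).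
    by apply/ffunP => k; rewrite !ffunE; case: eqP => [->|//]; rewrite (negPf ir).
  rewrite -multilinearZ; congr (f _); apply/ffunP => k; rewrite !ffunE inE.
  by case: eqP => [->|].
rewrite -[in RHS]big_enum -main ?enum_uniq //; congr f.
by apply/ffunP => i; rewrite !ffunE mem_enum.
Qed.

End Multilinear.

Section ListMultilinear.
Variables (K : fieldType) (A B : lmodType K).

(** Lists, unlike families indexed by ordinals, can be built block by block. *)
Definition multilinear_list (r : nat) (q : seq A -> B) : Prop :=
  forall s1 s2, (size s1 + size s2).+1 = r -> linear (fun x => q (s1 ++ x :: s2)).

Lemma multilinear_of_list n (q : seq A -> B) (p : 'I_n -> A -> A) :
  multilinear_list n q -> (forall i, linear (p i)) ->
  multilinear (fun a : {ffun 'I_n -> A} => q [seq p i (a i) | i <- enum 'I_n]).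
Proof.
move=> qml pl a i.
have /splitPr spl : i \in enum 'I_n by rewrite mem_enum.
have := enum_uniq 'I_n; have := size_enum_ord n.
case: spl => r1 r2 sz; rewrite cat_uniq /= negb_or => /and3P [_ /andP [ir1 _] /andP [ir2 _]].
have E x : [seq p j (ffun_upd a i x j) | j <- r1 ++ i :: r2] =
    [seq p j (a j) | j <- r1] ++ p i x :: [seq p j (a j) | j <- r2].
  rewrite map_cat /= ffun_updE eqxx; congr (_ ++ _ :: _); apply/eq_in_map => j jr;
    rewrite ffun_updE; case: eqP => // ji; first by rewrite -ji jr in ir1.
  by rewrite -ji jr in ir2.
move=> c x y; rewrite !E pl qml // !size_map.
by move: sz; rewrite size_cat /= addnS.
Qed.

Lemma multilinear_list_cat r n (q : seq A -> B) v : multilinear_list (n + r) q ->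
  size v = n -> multilinear_list r (fun t => q (v ++ t)).
Proof.
move=> qml vn s1 s2 sz c x y; rewrite !catA qml // size_cat vn -sz.
by rewrite addnS addnA.
Qed.

End ListMultilinear.

Section Alternation.
Variables (K : fieldType) (A B : lmodType K) (n : nat).
Implicit Types (q : {ffun 'I_n -> A} -> B) (z : 'I_n -> A).

Definition alt_sum q z : B :=
  \sum_(s : 'S_n) (-1) ^+ s *: q [ffun i => z (s i)].

(** The alternating sum is multilinear and alternating in its arguments, hence
    transforms by the determinant under linear substitutions, as in the proof
    of the product rule for determinants. *)
Lemma alt_sum_mul q z (X : 'M[K]_n) : multilinear q ->
  alt_sum q (fun i => \sum_j X i j *: z j) = \det X *: alt_sum q z.
Proof.
move=> qml; rewrite /alt_sum.
pose F := {ffun 'I_n -> 'I_n}.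
transitivity (\sum_(p : F)
    \det (\matrix_(i, j) X j (p i)) *: q [ffun i => z (p i)]).
  transitivity (\sum_(s : 'S_n) \sum_(p : F)
      ((-1) ^+ s * \prod_i X (s i) (p i)) *: q [ffun i => z (p i)]).
    apply: eq_bigr => s _.
    rewrite (multilinear_expand qml (fun i j => X (s i) j *: z j) [ffun i => i]).
    rewrite scaler_sumr; apply: eq_bigr => p _; rewrite -scalerA; congr (_ *: _).
    rewrite -(multilinear_scale qml); congr q.
    by apply/ffunP => i; rewrite !ffunE.
  rewrite exchange_big; apply: eq_bigr => p _ /=; rewrite -scaler_suml.
  congr (_ *: _); apply: eq_bigr => s _; congr (_ * _).
  by apply: eq_bigr => i _; rewrite mxE.
rewrite (bigID (fun p : F => injectiveb p)) /= addrC big1 ?add0r => [|p]; last first.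
  case/injectivePn => i1 [i2 ne12 eq12].
  rewrite (determinant_alternate ne12) ?scale0r // => j.
  by rewrite !mxE eq12.
rewrite (reindex (@pval _)) /=; last first.
  pose in_Sn := insubd (1%g : 'S_n).
  by exists in_Sn => /= p Up; first apply: val_inj; apply: insubdK.
rewrite scaler_sumr; apply: eq_big => /= [s|s _]; first by rewrite (valP s).
rewrite scalerA; congr (_ *: _); last first.
  by congr (q _); apply/ffunP => i; rewrite !ffunE pvalE.
transitivity (\det (row_perm s X^T)).
  by congr determinant; apply/matrixP => i j; rewrite !mxE pvalE.
by rewrite row_permE det_mulmx det_perm det_tr mulrC.
Qed.

(** A relation expresses z as X z with a matrix X that has a zero column. *)
Lemma alt_sum_dep q z (i0 : 'I_n) (c : 'I_n -> K) : multilinear q ->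
  z i0 = \sum_(j | j != i0) c j *: z j -> alt_sum q z = 0.
Proof.
move=> qml zi0.
pose X : 'M[K]_n := \matrix_(i, j) if i == i0 then (if j == i0 then 0 else c j)
                                   else (i == j)%:R.
have zX i : z i = \sum_j X i j *: z j.
  have [->|ne] := eqVneq i i0.
    rewrite zi0 [RHS](bigD1 i0) //= !mxE !eqxx scale0r add0r.
    by apply: eq_bigr => j /negPf ji; rewrite !mxE eqxx ji.
  rewrite (bigD1 i) //= big1 ?addr0 => [|j ji].
    by rewrite !mxE (negPf ne) eqxx scale1r.
  by rewrite !mxE (negPf ne) eq_sym (negPf ji) scale0r.
have -> : alt_sum q z = alt_sum q (fun i => \sum_j X i j *: z j).
  apply: eq_bigr => s _; congr (_ *: q _); apply/ffunP => i.
  by rewrite !ffunE -zX.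
rewrite (alt_sum_mul z X qml) (_ : \det X = 0) ?scale0r //.
rewrite (expand_det_col _ i0) big1 // => i _; rewrite mxE eqxx.
by case: eqP => [|/eqP/negPf]; rewrite ?mul0r // => ->; rewrite mul0r.
Qed.

End Alternation.

(** * Homogeneous bases and homogeneous components *)

Lemma ex_linfun (K : fieldType) (U V : vectType K) (f : U -> V) :
  linear f -> exists F : 'Hom(U, V), forall x, F x = f x.
Proof.
move=> lf.
pose mf := GRing.isLinear.Build K U V _ f lf.
pose fL : {linear U -> V} := HB.pack f mf.
by exists (linfun fL) => x; rewrite lfunE.
Qed.

Section DirectDecomposition.
Variables (K : fieldType) (G : semigroupType) (A : vectType K).
Variables (V : {vspace A}) (W : G -> {vspace A}).
Hypothesis dVW : direct_decomposition V W.

Lemma direct_decomposition_indep (S : {fset G}) (c : G -> A) :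
  (forall g, c g \in W g) -> \sum_(g <- S) c g = 0 ->
  forall g, g \in S -> c g = 0.
Proof.
move=> cW c0 g gS; have [_ dV] := dVW.
have [c1 [_ uniq_c]] := dV 0 (mem0v V).
have e1 : c1 = [fsfun] by apply: uniq_c; split=> [h|]; rewrite ?fsfunE ?mem0v //=;
  rewrite finsupp0 big_nil.
have e2 : c1 = [fsfun h in S => c h | 0].
  apply: uniq_c; split=> [h|].
    by rewrite fsfunE; case: ifP => // _; apply: mem0v.
  rewrite -[LHS]c0; apply/esym.
  have sub : (finsupp [fsfun h in S => c h | 0] `<=` S)%fset.
    by apply/fsubsetP => h; rewrite mem_finsupp fsfunE; case: ifP => // _; rewrite eqxx.
  rewrite (big_fset_incl _ sub) /=; last first.
    by move=> h _; rewrite memNfinsupp => /eqP.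
  by rewrite !big_seq; apply: eq_bigr => h hS; rewrite fsfunE hS.
by have := congr1 (fun f : {fsfun G -> A with 0} => f g) e2; rewrite e1 !fsfunE gS.
Qed.

Lemma direct_decomposition_sum v : v \in V ->
  exists2 s : seq A, (forall x, x \in s -> exists g, x \in W g) &
    v = \sum_(x <- s) x.
Proof.
case: dVW => _ dV /dV [c [[cW ->] _]].
exists [seq c g | g <- finsupp c]; last by rewrite big_map.
by move=> x /mapP [g _ ->]; exists g.
Qed.

End DirectDecomposition.

Section HomogeneousBasis.
Variables (K : fieldType) (Omega : signature) (G : semigroupType).
Variables (deg0 : Omega 0%N -> G) (A : fd_graded_alg K deg0).

Definition homogeneous (x : A) : Prop := exists g, x \in ga_comp A g.

Definition homogeneous_basis n (e : n.-tuple A) (d : 'I_n -> G) : Prop :=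
  basis_of fullv e /\ forall i, tnth e i \in ga_comp A (d i).

Lemma homogeneous_free_span (s : seq A) : (forall x, x \in s -> homogeneous x) ->
  exists t : seq A, [/\ forall x, x \in t -> homogeneous x, free t &
    <<t>>%VS = <<s>>%VS].
Proof.
elim: s => [_|x s IHs hs]; first by exists [::]; split=> //; apply: nil_free.
have [|t [ht ft ts]] := IHs; first by move=> y ys; apply: hs; rewrite inE ys orbT.
have [xt|xt] := boolP (x \in <<t>>%VS).
  by exists t; split=> //; rewrite span_cons -ts; apply/esym/addv_idPr.
exists (x :: t); split; last by rewrite !span_cons ts.
  by move=> y; rewrite inE => /predU1P [->|/ht //]; apply: hs; rewrite inE eqxx.
by rewrite free_cons xt.
Qed.

Lemma homogeneous_basis_exists :
  exists n (e : n.-tuple A) (d : 'I_n -> G), homogeneous_basis e d.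
Proof.
have span_hom (r : seq A) : exists2 s : seq A, (forall x, x \in s -> homogeneous x) &
    (<<r>> <= <<s>>)%VS.
  elim: r => [|v r [s hs rs]]; first by exists [::]; rewrite ?subvv.
  have [s' hs' ->] := direct_decomposition_sum (ga_direct A) (memvf v).
  exists (s' ++ s) => [x|].
    by rewrite mem_cat => /orP [/hs'|/hs].
  rewrite span_cons span_cat subv_add; apply/andP; split; last first.
    exact: subv_trans rs (addvSr _ _).
  rewrite -memvE; apply/(subvP (addvSl _ _)); rewrite big_seq.
  by apply: rpred_sum => x xs; apply: memv_span.
have [s hs vs] := span_hom (vbasis {:A}).
have [t [ht ft ts]] := homogeneous_free_span hs.
have bt : basis_of fullv (in_tuple t).
  rewrite /basis_of ft andbT eqEsubv subvf ts /=.
  by rewrite -{1}(span_basis (vbasisP fullv)).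
have [d dP] : exists d : 'I_(size t) -> G, forall i, tnth (in_tuple t) i \in ga_comp A (d i).
  have [d dP] := choice (fun i => ht _ (mem_tnth i (in_tuple t))).
  by exists d.
by exists (size t), (in_tuple t), d.
Qed.

Variables (n : nat) (e : n.-tuple A) (d : 'I_n -> G).
Hypothesis ed : homogeneous_basis e d.
Let e_basis : basis_of fullv e := ed.1.
Let e_free : free e := basis_free e_basis.

Lemma coord_sum v : v = \sum_i coord e i v *: tnth e i.
Proof.
rewrite {1}(coord_basis e_basis (memvf v)); apply: eq_bigr => i _.
by rewrite (tnth_nth 0).
Qed.

Lemma coord_sumE (c : 'I_n -> K) i :
  coord e i (\sum_j c j *: tnth e j) = c i.
Proof.
rewrite -[RHS](coord_sum_free c i e_free); congr (coord e i _).
by apply: eq_bigr => j _; rewrite (tnth_nth 0).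
Qed.

Lemma coord_tnth i j : coord e i (tnth e j) = (i == j)%:R.
Proof. by rewrite (tnth_nth 0) coord_free // -val_eqE eq_sym. Qed.

Lemma coord_inj u v : (forall i, coord e i u = coord e i v) -> u = v.
Proof.
by move=> uv; rewrite (coord_sum u) (coord_sum v); apply: eq_bigr => i _; rewrite uv.
Qed.

Definition hproj_fun (g : G) (v : A) : A :=
  \sum_(i | d i == g) coord e i v *: tnth e i.

Lemma hproj_fun_linear g : linear (hproj_fun g).
Proof.
move=> c u v; rewrite /hproj_fun scaler_sumr -big_split; apply: eq_bigr => i _ /=.
by rewrite linearP scalerDl scalerA.
Qed.
HB.instance Definition _ g :=
  GRing.isLinear.Build K A A _ (hproj_fun g) (hproj_fun_linear g).

Definition hproj (g : G) : 'End(A) := linfun (hproj_fun g).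

Lemma hprojE g v : hproj g v = \sum_(i | d i == g) coord e i v *: tnth e i.
Proof. by rewrite lfunE. Qed.

Lemma hproj_mem g v : hproj g v \in ga_comp A g.
Proof.
rewrite hprojE; apply: rpred_sum => i /eqP <-; apply: rpredZ; exact: ed.2.
Qed.

Lemma coord_hproj g v i : coord e i (hproj g v) = if d i == g then coord e i v else 0.
Proof.
rewrite hprojE big_mkcond /=.
rewrite (eq_bigr (fun j => (if d j == g then coord e j v else 0) *: tnth e j)).
  by rewrite coord_sumE.
by move=> j _; case: ifP => //; rewrite scale0r.
Qed.

(** The decomposition of v read off from its coordinates in the basis has to be
    the trivial one. *)
Lemma hproj_id g v : v \in ga_comp A g -> hproj g v = v.
Proof.
move=> vg.
pose S : {fset G} := ([fset g] `|` [fset d i | i in 'I_n])%fset.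
pose c h := hproj h v - (if h == g then v else 0).
have cW h : c h \in ga_comp A h.
  rewrite rpredB ?hproj_mem //; have [->|_] := eqVneq h g; first exact: vg.
    exact: mem0v.
have sumc : \sum_(h <- S) c h = 0.
  rewrite sumrB; apply/eqP; rewrite subr_eq0; apply/eqP.
  transitivity v; last first.
    rewrite (big_fsetD1 g) ?inE ?eqxx //= big_seq big1 ?addr0 // => h.
    by rewrite !inE => /andP [/negPf ->].
  rewrite [RHS]coord_sum.
  rewrite (eq_bigr (fun h => \sum_(i | d i == h) coord e i v *: tnth e i)); last first.
    by move=> h _; rewrite hprojE.
  rewrite (exchange_big_dep predT) //=; apply: eq_bigr => i _.
  have diS : d i \in S by rewrite !inE; apply/orP; right; apply/imfsetP; exists i.
  rewrite big_mkcond (big_fsetD1 (d i)) //= eqxx big_seq big1 ?addr0 // => h.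
  by rewrite !inE eq_sym => /andP [/negPf ->].
have gS : g \in S by rewrite !inE eqxx.
have := direct_decomposition_indep (ga_direct A) cW sumc gS.
by rewrite /c eqxx => /eqP; rewrite subr_eq0 => /eqP.
Qed.

Lemma hproj_other g h v : v \in ga_comp A h -> h != g -> hproj g v = 0.
Proof.
move=> /hproj_id <- hg; apply: coord_inj => i; rewrite !coord_hproj linear0.
by case: eqP => // ->; rewrite eq_sym (negPf hg).
Qed.

Lemma coord_comp g v i : v \in ga_comp A g -> d i != g -> coord e i v = 0.
Proof. by move=> /hproj_id <- /negPf dg; rewrite coord_hproj dg. Qed.

Lemma compP g v :
  reflect (forall i, d i != g -> coord e i v = 0) (v \in ga_comp A g).
Proof.
apply: (iffP idP) => [vg i|h]; first exact: coord_comp.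
suff <- : hproj g v = v by apply: hproj_mem.
apply: coord_inj => i; rewrite coord_hproj; case: eqP => // /eqP dg.
by rewrite h.
Qed.

Let ds : seq G := undup (codom d).

Lemma hproj_sum v : v = \sum_(g <- ds) hproj g v.
Proof.
apply: coord_inj => i; rewrite linear_sum /=.
have dids : d i \in ds by rewrite mem_undup codom_f.
rewrite (bigD1_seq (d i)) ?undup_uniq //= coord_hproj eqxx big1 ?addr0 // => g.
by rewrite coord_hproj eq_sym => /negPf ->.
Qed.

Lemma hproj_decomp v :
  exists2 s : seq A, (forall x, x \in s -> exists g, x = hproj g v) &
    v = \sum_(x <- s) x.
Proof.
exists [seq hproj g v | g <- ds]; last by rewrite big_map -hproj_sum.
by move=> x /mapP [g _ ->]; exists g.
Qed.

(** The submodules for the algebra of operators generated by the projections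
    onto the components and by the operations with all arguments but one fixed
    and homogeneous. *)
Definition stable (I : {vspace A}) : Prop :=
  (forall g v, v \in I -> hproj g v \in I) /\
  forall m (w : Omega m) (a : {ffun 'I_m -> A}) i,
    (forall j, homogeneous (a j)) -> a i \in I -> omega_op (ga_str A) w a \in I.

(** The summands of the arguments of an operation may be taken homogeneous, so
    stability under homogeneous arguments is enough for an ideal. *)
Lemma stable_graded_ideal I : stable I -> is_graded_ideal I.
Proof.
case=> projI opI; split.
  move=> m w a i aiI.
  apply: (multilinear_ind (f := omega_op (ga_str A) w) (omega_opP _ _)
    (S := fun j x => homogeneous x /\ (j = i -> x \in I)) (Q := fun x => x \in I)).
  - exact: mem0v.
  - by move=> x y; apply: rpredD.
  - move=> a' Sa'; apply: (opI _ _ _ i) => [j|]; first by case: (Sa' j).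
    by case: (Sa' i) => _; apply.
  move=> j; have [s hs ->] := hproj_decomp (a j); exists s => // x /hs [g ->].
  split; first by exists g; apply: hproj_mem.
  by move=> ->; apply: projI.
split=> [g|v vI]; first exact: capvSl.
pose S : {fset G} := [fset d i | i in 'I_n]%fset.
have S0 h u : h \notin S -> hproj h u = 0.
  move=> hS; rewrite hprojE big1 // => i /eqP dih; case/negP: hS.
  by rewrite -dih; apply/imfsetP; exists i.
have supp0 h : h \notin S -> [fsfun h in S => hproj h v | 0] h = 0.
  by rewrite fsfunE => /negPf ->.
have cE h : [fsfun h in S => hproj h v | 0] h = hproj h v.
  by rewrite fsfunE; case: ifP => // /negbT /S0 ->.
exists [fsfun h in S => hproj h v | 0]; split.
  split=> [g|]; first by rewrite cE memv_cap projI ?hproj_mem.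
  rewrite (big_fset_incl _ (B := S)) /=; last 2 first.
  - by apply/fsubsetP => h; rewrite mem_finsupp; apply: contraR => /supp0 ->.
  - by move=> h _; rewrite memNfinsupp => /eqP.
  rewrite [LHS]coord_sum.
  rewrite [RHS](eq_bigr (fun h => \sum_(i | d i == h) coord e i v *: tnth e i)); last first.
    by move=> h _; rewrite cE hprojE.
  rewrite (exchange_big_dep predT) //=; apply: eq_bigr => i _.
  have diS : d i \in S by apply/imfsetP; exists i.
  rewrite big_mkcond (big_fsetD1 (d i)) //= eqxx big_seq big1 ?addr0 // => h.
  by rewrite !inE eq_sym => /andP [/negPf ->].
move=> c [cI vc]; apply/fsfunP => g; rewrite cE vc linear_sum /=.
have cg h : c h \in ga_comp A h by have := cI h; rewrite memv_cap => /andP [].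
have [gc|gc] := boolP (g \in finsupp c).
  rewrite (big_fsetD1 g) //= hproj_id // big_seq big1 ?addr0 // => h.
  by rewrite !inE => /andP [hg _]; apply: hproj_other hg.
rewrite big_seq big1; first by move: gc; rewrite memNfinsupp => /eqP.
move=> h hc; apply: (hproj_other (cg h)); apply: contraNneq gc => <-; exact: hc.
Qed.

(** The arguments provided by primeness can be replaced by homogeneous ones:
    the operation does not vanish on some choice of their components. *)
Lemma prime_stable I J : graded_prime A -> stable I -> stable J ->
  I != 0%VS -> J != 0%VS ->
  exists m (w : Omega m) (i j : 'I_m) (a : {ffun 'I_m -> A}),
    [/\ i != j, forall l, homogeneous (a l), a i \in I, a j \in J &
        omega_op (ga_str A) w a != 0].
Proof.
case=> _ pA sI sJ I0 J0.
have [m [w [i [j [a [_ ij aI aJ]]]]]] :=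
  pA I J (stable_graded_ideal sI) (stable_graded_ideal sJ) I0 J0.
move=> /eqP wa0; exists m, w, i, j; apply: contrapT => no; apply: wa0.
apply: (multilinear_ind (f := omega_op (ga_str A) w) (omega_opP _ _)
  (S := fun l x => [/\ homogeneous x, l = i -> x \in I & l = j -> x \in J])
  (Q := fun x => x = 0)) => //.
- by move=> x y -> ->; rewrite addr0.
- move=> a' Sa'; apply: contrapT => /eqP wa'; apply: no; exists a'; split=> //.
  + by move=> l; case: (Sa' l).
  + by case: (Sa' i) => _ + _; apply.
  + by case: (Sa' j) => _ _; apply.
move=> l; have [s hs ->] := hproj_decomp (a l); exists s => // x /hs [g ->].
split; first by exists g; apply: hproj_mem.
- by move=> ->; apply: sI.1.
- by move=> ->; apply: sJ.1.
Qed.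

End HomogeneousBasis.
(** * Evaluation of graded polynomials *)

(** The defect of a linear map as a homomorphism is multilinear, hence vanishes
    as soon as it vanishes on a spanning set. *)
Lemma hom_defect_multilinear (K : fieldType) (Omega : signature) (C D : lmodType K)
    (sC : omega_str Omega C) (sD : omega_str Omega D) (phi : {linear C -> D})
    m (w : Omega m) :
  multilinear (fun a : {ffun 'I_m -> C} =>
    phi (omega_op sC w a) - omega_op sD w [ffun i => phi (a i)]).
Proof.
move=> a i c x y.
have E z : [ffun j => phi (ffun_upd a i z j)] = ffun_upd [ffun j => phi (a j)] i (phi z).
  by apply/ffunP => j; rewrite !ffunE; case: eqP.
by rewrite !E linearP !omega_opP linearP scalerBr opprD addrACA.
Qed.

Lemma hom_span (K : fieldType) (Omega : signature) (C D : lmodType K)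
    (sC : omega_str Omega C) (sD : omega_str Omega D) (phi : {linear C -> D})
    (I : Type) (b : I -> C) :
  (forall x, exists s : seq (K * I), x = \sum_(p <- s) p.1 *: b p.2) ->
  (forall m (w : Omega m) (u : 'I_m -> I),
     phi (omega_op sC w [ffun i => b (u i)]) =
     omega_op sD w [ffun i => phi (b (u i))]) ->
  omega_hom sC sD phi.
Proof.
move=> bspan bhom m w a; apply/eqP; rewrite -subr_eq0; apply/eqP.
have ml := hom_defect_multilinear sC sD phi w.
apply: (multilinear_ind ml (S := fun _ x => exists p, x = p.1 *: b p.2)
  (Q := fun x => x = 0)) => //.
- by move=> x y -> ->; rewrite addr0.
- move=> a' /choice [p pE].
  have -> : a' = [ffun i => (p i).1 *: [ffun i => b (p i).2] i].
    by apply/ffunP => i; rewrite !ffunE.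
  rewrite (multilinear_scale ml) bhom [X in _ - omega_op _ _ X](_ : _ =
    [ffun i => phi (b (p i).2)]) ?subrr ?scaler0 //.
  by apply/ffunP => i; rewrite !ffunE.
move=> i; have [s ->] := bspan (a i).
exists [seq p.1 *: b p.2 | p <- s]; last by rewrite big_map.
by elim: s => //= p s IHs x; rewrite inE => /predU1P [->|/IHs //]; exists p.
Qed.

Section ScaledMonomial.
Import monalg.

Lemma malgUZ (K : fieldType) (M : choiceType) (c : K) (u : M) :
  << c *g u >> = c *: << u >> :> {malg K[M]}.
Proof. by apply/malgP => v; rewrite mcoeffZ 2!mcoeffU mulrnAr mulr1. Qed.

End ScaledMonomial.

Section Evaluation.
Import monalg.
Variables (K : fieldType) (Omega : signature) (X : choiceType).
Variables (A : lmodType K) (sA : omega_str Omega A) (theta : X -> A).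
Local Notation F := (free_alg K Omega X).

Fixpoint monomial_eval (u : monomial Omega X) : A :=
  match u with
  | MVar x => theta x
  | MOp m w a => omega_op sA w [ffun i => monomial_eval (a i)]
  end.

Definition free_eval_fun (f : F) : A :=
  \sum_(u <- msupp f) f@_u *: monomial_eval u.

Lemma free_eval_funEw (S : {fset monomial Omega X}) (f : F) :
  (msupp f `<=` S)%fset -> free_eval_fun f = \sum_(u <- S) f@_u *: monomial_eval u.
Proof.
move=> fS; rewrite /free_eval_fun (big_fset_incl _ fS) // => u _.
by move=> /mcoeff_outdom ->; rewrite scale0r.
Qed.

Lemma free_eval_linear : linear free_eval_fun.
Proof.
move=> c f g; pose S := (msupp f `|` msupp g)%fset.
rewrite !(@free_eval_funEw S); first last.
- apply: fsubset_trans (msuppD_le _ _) _.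
  by apply: fsetUSS => //; apply: msuppZ_le.
- exact: fsubsetUl.
- exact: fsubsetUr.
rewrite scaler_sumr -big_split; apply: eq_bigr => u _ /=.
by rewrite mcoeffD mcoeffZ scalerDl scalerA.
Qed.
HB.instance Definition _ :=
  GRing.isLinear.Build K F A _ free_eval_fun free_eval_linear.

Lemma free_eval_mon (u : monomial Omega X) : free_eval_fun << u >> = monomial_eval u.
Proof.
rewrite (free_eval_funEw (S := [fset u]%fset)) ?msuppU_le //.
by rewrite big_seq_fset1 mcoeffUU scale1r.
Qed.

Lemma free_eval_hom :
  omega_hom (free_str K Omega X) sA (free_eval_fun : {linear F -> A}).
Proof.
apply: (hom_span (b := fun u => << u >>)) => [f|m w u].
  exists [seq (f@_u, u) | u <- msupp f]; rewrite big_map {1}[f]monalgE.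
  by apply: eq_bigr => u _; apply: malgUZ.
have -> : [ffun i => << u i >> : F] = [ffun i => << [ffun i => u i] i >>].
  by apply/ffunP => i; rewrite !ffunE.
rewrite /= free_opU free_eval_mon /=.
by congr (omega_op _ _ _); apply/ffunP => i; rewrite !ffunE free_eval_mon.
Qed.

Lemma free_eval_exists : exists phi : {linear F -> A},
  omega_hom (free_str K Omega X) sA phi /\ forall x, phi << MVar Omega x >> = theta x.
Proof.
exists free_eval_fun; split; first exact: free_eval_hom.
by move=> x; rewrite /= free_eval_mon.
Qed.

End Evaluation.

Section IsomorphismInvariance.
Variables (K : fieldType) (Omega : signature) (G : semigroupType).
Variable deg0 : Omega 0%N -> G.
Implicit Types A B : fd_graded_alg K deg0.

Lemma graded_isomorphic_sym A B : graded_isomorphic A B -> graded_isomorphic B A.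
Proof.
case=> phi [phom phigr [psi phiK psiK]].
have psil : linear psi by apply: (can2_linear phiK psiK).
pose mpsi := GRing.isLinear.Build K B A _ psi psil.
pose psiL : {linear B -> A} := HB.pack psi mpsi.
exists psiL; split; last by exists phi.
  move=> m w b; apply: (can_inj phiK); rewrite psiK phom; congr (omega_op _ _ _).
  by apply/ffunP => i; rewrite !ffunE psiK.
move=> g b bg; have [n [e [d ed]]] := homogeneous_basis_exists A.
have [n' [e' [d' ed']]] := homogeneous_basis_exists B.
have comm a : hproj e' d' g (phi a) = phi (hproj e d g a).
  rewrite {1}(hproj_sum ed a) !linear_sum /= (bigID (pred1 g)) /= addrC big1 => [|h hg].
    rewrite add0r; have [gd|gd] := boolP (g \in undup (codom d)).
      by rewrite -big_filter filter_pred1_uniq ?undup_uniq // big_seq1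
              (hproj_id ed') // phigr // (hproj_mem ed).
    rewrite big_seq_cond big1 => [|h /andP [hd /eqP hg]]; last by rewrite -hg hd in gd.
    rewrite hprojE big1 ?linear0 // => i /eqP dig; case/negP: gd.
    by rewrite mem_undup -dig codom_f.
  by rewrite (hproj_other ed' _ hg) // phigr // (hproj_mem ed).
have -> : psiL b = hproj e d g (psi b).
  by apply: (can_inj phiK); rewrite -comm psiK (hproj_id ed').
exact: (hproj_mem ed).
Qed.

Lemma graded_isomorphic_identity A B f :
  graded_isomorphic A B -> graded_identity B f -> graded_identity A f.
Proof.
case=> phi [phom phigr /bij_inj phi_inj] fB xi xihom xigr; apply: phi_inj.
rewrite linear0; apply: (fB (phi \o xi)) => /= [m w a|k g].
  by rewrite /= xihom phom; congr (omega_op _ _ _); apply/ffunP => i; rewrite !ffunE.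
exact/phigr/xigr.
Qed.

End IsomorphismInvariance.

(** * Operators realised by graded polynomials *)

Section OperationDegree.
Variables (K : fieldType) (Omega : signature) (G : semigroupType).
Variable deg0 : Omega 0%N -> G.

Definition op_degree (m : nat) : Omega m -> ('I_m -> G) -> G :=
  match m return Omega m -> ('I_m -> G) -> G with
  | 0 => fun w _ => deg0 w
  | _.+1 => fun _ c => semigroup_prod c
  end.

Lemma op_degree_mem (A : fd_graded_alg K deg0) m (w : Omega m) (c : 'I_m -> G)
    (a : {ffun 'I_m -> A}) :
  (forall i, a i \in ga_comp A (c i)) ->
  omega_op (ga_str A) w a \in ga_comp A (op_degree w c).
Proof. by case: m w c a => [|m] w c a ac /=; [apply: ga_homog0 | apply: ga_homog]. Qed.

End OperationDegree.

Section Realizable.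
Variables (K : fieldType) (Omega : signature) (G : semigroupType).
Variable deg0 : Omega 0%N -> G.
Variables A B : fd_graded_alg K deg0.
Variables (n : nat) (e : n.-tuple A) (d : 'I_n -> G).
Hypothesis ed : homogeneous_basis e d.
Local Notation F := (graded_poly K Omega G).
Local Notation strF := (free_str K Omega (nat * G)%type).
Local Notation pi := (hproj e d).

(** The letters of index n + i serve as parameters that stand for the vectors
    of the basis. As the operations are multilinear, the same parameters can be
    used at every place where a constant is needed. *)
Definition frame (phi : {linear F -> A}) : Prop :=
  omega_hom strF (ga_str A) phi /\
  forall i : 'I_n, phi (graded_var K Omega (n + i) (d i)) = tnth e i.

Definition const_poly (a : A) : F :=
  \sum_i coord e i a *: graded_var K Omega (n + i) (d i).

Lemma frame_const phi a : frame phi -> phi (const_poly a) = a.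
Proof.
case=> _ phiE; rewrite linear_sum [RHS](coord_sum ed) /=.
by apply: eq_bigr => i _; rewrite linearZ /= phiE.
Qed.

(** Substitution into one place of a polynomial has this property: evaluated
    in B, it becomes a linear operator. Nothing else has to be known about the
    behaviour of polynomials on B. *)
Definition natural (T : F -> F) : Prop :=
  forall eta : {linear F -> B}, omega_hom strF (ga_str B) eta ->
  exists2 D : B -> B, linear D & forall f, eta (T f) = D (eta f).

Lemma natural0 : natural (fun=> 0).
Proof.
move=> eta _; exists (fun=> 0) => [c x y|f]; first by rewrite scaler0 addr0.
by rewrite linear0.
Qed.

Lemma natural_id : natural id.
Proof. by move=> eta _; exists id. Qed.

Lemma naturalD T1 T2 : natural T1 -> natural T2 -> natural (fun f => T1 f + T2 f).
Proof.
move=> N1 N2 eta etah; have [D1 l1 E1] := N1 _ etah; have [D2 l2 E2] := N2 _ etah.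
exists (fun x => D1 x + D2 x) => [c x y|f]; last by rewrite linearD /= E1 E2.
by rewrite l1 l2 scalerDr addrACA.
Qed.

Lemma naturalZ c T : natural T -> natural (fun f => c *: T f).
Proof.
move=> N eta etah; have [D l E] := N _ etah.
exists (fun x => c *: D x) => [b x y|f]; last by rewrite linearZ /= E.
by rewrite l scalerDr !scalerA mulrC.
Qed.

Lemma natural_sum (I : Type) (r : seq I) (T : I -> F -> F) :
  (forall i, natural (T i)) -> natural (fun f => \sum_(i <- r) T i f).
Proof.
move=> N; elim: r => [|i r IHr].
  by under eq_fun do rewrite big_nil; apply: natural0.
by under eq_fun do rewrite big_cons; apply: naturalD.
Qed.

Lemma natural_comp T1 T2 : natural T1 -> natural T2 -> natural (fun f => T1 (T2 f)).
Proof.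
move=> N1 N2 eta etah; have [D1 l1 E1] := N1 _ etah; have [D2 l2 E2] := N2 _ etah.
by exists (fun x => D1 (D2 x)) => [c x y|f]; rewrite ?l2 ?l1 // E1 E2.
Qed.

Lemma hom_upd (C : fd_graded_alg K deg0) (eta : {linear F -> C}) m (w : Omega m)
    (u : {ffun 'I_m -> F}) i f :
  omega_hom strF (ga_str C) eta ->
  eta (omega_op strF w (ffun_upd u i f)) =
  omega_op (ga_str C) w (ffun_upd [ffun j => eta (u j)] i (eta f)).
Proof.
move=> ->; congr (omega_op _ _ _); apply/ffunP => j; rewrite !ffunE.
by case: eqP.
Qed.

Lemma natural_slot m (w : Omega m) (u : {ffun 'I_m -> F}) i :
  natural (fun f => omega_op strF w (ffun_upd u i f)).
Proof.
move=> eta etah; exists (fun x => omega_op (ga_str B) w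
  (ffun_upd [ffun j => eta (u j)] i x)); first exact: omega_opP.
by move=> f; apply: hom_upd.
Qed.

(** Graded polynomials have no means to project an inhomogeneous value, but on
    arguments of a known degree h each component of D can be expressed: the
    operations of homogeneous arguments are homogeneous. Hence one polynomial
    for each pair of degrees. *)
Definition realizable (D : 'End(A)) : Prop :=
  forall h g, exists2 T : F -> F, natural T &
    forall phi, frame phi -> forall f, phi f \in ga_comp A h ->
      phi (T f) = pi g (D (phi f)).

Lemma hproj_if g h v : v \in ga_comp A h -> pi g v = if g == h then v else 0.
Proof.
move=> vh; case: eqP => [->|/eqP gh]; first exact: hproj_id.
by apply: (hproj_other ed vh); rewrite eq_sym.
Qed.

Lemma realizable_hproj g' : realizable (pi g').
Proof.
move=> h g; exists (if (g == h) && (g' == h) then id else fun=> 0).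
  by case: ifP => _; [apply: natural_id | apply: natural0].
move=> phi _ f fh; rewrite (hproj_if g' fh) andbC.
case: eqP => _ /=; last by rewrite !linear0.
by rewrite (hproj_if g fh); case: eqP => _ //; rewrite linear0.
Qed.

Lemma realizable_id : realizable \1%VF.
Proof.
move=> h g; exists (if g == h then id else fun=> 0).
  by case: ifP => _; [apply: natural_id | apply: natural0].
move=> phi _ f fh; rewrite id_lfunE (hproj_if g fh).
by case: eqP => // _; rewrite linear0.
Qed.

Lemma realizableD D1 D2 : realizable D1 -> realizable D2 -> realizable (D1 + D2).
Proof.
move=> R1 R2 h g; have [T1 N1 E1] := R1 h g; have [T2 N2 E2] := R2 h g.
exists (fun f => T1 f + T2 f); first exact: naturalD.
by move=> phi fphi f fh; rewrite !linearD /= E1 // E2 // add_lfunE linearD.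
Qed.

Lemma realizableZ c D : realizable D -> realizable (c *: D).
Proof.
move=> R h g; have [T N E] := R h g.
exists (fun f => c *: T f); first exact: naturalZ.
by move=> phi fphi f fh; rewrite linearZ /= E // scale_lfunE linearZ.
Qed.

Lemma realizable_comp D1 D2 : realizable D1 -> realizable D2 -> realizable (D1 \o D2)%VF.
Proof.
move=> R1 R2 h g.
have /choice [T1 T1P] : forall g', exists T, natural T /\
    forall phi, frame phi -> forall f, phi f \in ga_comp A g' ->
      phi (T f) = pi g (D1 (phi f)).
  by move=> g'; have [T N E] := R1 g' g; exists T.
have /choice [T2 T2P] : forall g', exists T, natural T /\
    forall phi, frame phi -> forall f, phi f \in ga_comp A h ->
      phi (T f) = pi g' (D2 (phi f)).
  by move=> g'; have [T N E] := R2 h g'; exists T.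
(* The intermediate value is split into its components. *)
exists (fun f => \sum_(g' <- undup (codom d)) T1 g' (T2 g' f)).
  by apply: natural_sum => g'; apply: natural_comp; [apply: (T1P g').1|apply: (T2P g').1].
move=> phi fphi f fh; rewrite comp_lfunE [in RHS](hproj_sum ed (D2 (phi f))).
rewrite !linear_sum /=; apply: eq_bigr => g' _.
have [_ E1] := T1P g'; have [_ E2] := T2P g'.
by rewrite E1 // E2 // (hproj_mem ed).
Qed.

Lemma realizable_slot m (w : Omega m) (a : {ffun 'I_m -> A}) i (D : 'End(A)) :
  (forall j, homogeneous (a j)) ->
  (forall x, D x = omega_op (ga_str A) w (ffun_upd a i x)) -> realizable D.
Proof.
move=> /choice [c ac] DE h g.
pose g0 := op_degree deg0 w (fun j => if j == i then h else c j).
pose u : {ffun 'I_m -> F} := [ffun j => const_poly (a j)].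
exists (if g == g0 then fun f => omega_op strF w (ffun_upd u i f) else fun=> 0).
  by case: ifP => _; [apply: natural_slot | apply: natural0].
move=> phi fphi f fh; rewrite DE.
have Dg0 : omega_op (ga_str A) w (ffun_upd a i (phi f)) \in ga_comp A g0.
  by apply: op_degree_mem => j; rewrite ffunE; case: eqP.
rewrite (hproj_if g Dg0); case: eqP => _; last by rewrite linear0.
rewrite (hom_upd _ _ _ _ fphi.1); congr (omega_op _ _ (ffun_upd _ _ _)).
by apply/ffunP => j; rewrite !ffunE frame_const.
Qed.

End Realizable.
(** * Density: rank one operators with values in a minimal submodule *)

Section Eigenvector.
Variables (K : closedFieldType) (V : vectType K).

Lemma closed_eigenvector (f : 'End(V)) (U : {vspace V}) :
  U != 0%VS -> (forall u, u \in U -> f u \in U) ->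
  exists mu, exists2 u, u \in U & u != 0 /\ f u = mu *: u.
Proof.
move=> U0 fU; pose b := vbasis U; pose k := \dim U.
have bU i : tnth b i \in U by apply/vbasis_mem/mem_tnth.
pose M : 'M[K]_k := \matrix_(i, j) coord b j (f (tnth b i)).
have [mu mu_root] : exists mu, root (char_poly M) mu.
  by apply/closed_rootP; rewrite size_char_poly eqSS dimv_eq0.
move: mu_root; rewrite -eigenvalue_root_char => /eigenvalueP [v vM v0].
exists mu, (\sum_i v 0 i *: tnth b i).
  by apply: rpred_sum => i _; apply: rpredZ.
split.
  apply: contraNneq v0 => sum0; apply/eqP/rowP => i; rewrite mxE.
  have := coord_sum_free (v 0) i (basis_free (vbasisP U)).
  rewrite (eq_bigr (fun i => v 0 i *: tnth b i)); last by move=> j _; rewrite (tnth_nth 0).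
  by rewrite sum0 linear0.
have fb i : f (tnth b i) = \sum_j M i j *: tnth b j.
  rewrite {1}(coord_vbasis (fU _ (bU i))); apply: eq_bigr => j _.
  by rewrite mxE (tnth_nth 0 _ j).
rewrite linear_sum /=.
under eq_bigr do rewrite linearZ /= fb scaler_sumr.
rewrite exchange_big scaler_sumr; apply: eq_bigr => j _ /=.
have /rowP/(_ j) := vM; rewrite !mxE scalerA => <-.
by rewrite scaler_suml; apply: eq_bigr => i _; rewrite scalerA.
Qed.

End Eigenvector.

Section Functionals.
Variables (K : fieldType) (V : vectType K).
Local Notation dual := 'Hom(V, K^o).

(** Finitely many functionals in P, chosen with least common kernel, have no
    common zero but 0; they define an injection into a space of rows, and l
    factors through a left inverse of it. *)
Lemma separating_span (P : dual -> Prop) :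
  P 0 -> (forall c l1 l2, P l1 -> P l2 -> P (c *: l1 + l2)) ->
  (forall v, v != 0 -> exists2 l, P l & l v != 0) ->
  forall l, P l.
Proof.
move=> P0 PL sep l.
pose common (s : seq dual) : {vspace V} := (\bigcap_(l <- s) lker l)%VS.
have [s sP s0] : exists2 s, (forall l, l \in s -> P l) & common s = 0%VS.
  have [k] := ubnP (\dim (common [::])).
  have : forall l, l \in [::] -> P l by [].
  elim: k [::] => // k IHk s sP; rewrite ltnS => dk.
  have [s0|s0] := eqVneq (common s) 0%VS; first by exists s.
  have [v vs v0] : exists2 v, v \in common s & v != 0.
    by exists (vpick (common s)); rewrite ?memv_pick ?vpick0.
  have [l1 Pl1 l1v] := sep v v0.
  apply: (IHk (l1 :: s)) => [l2|].
    by rewrite inE => /predU1P [->|/sP].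
  apply: leq_trans dk; rewrite ltnNge; apply: contra l1v => dle.
  have sub : (common (l1 :: s) <= common s)%VS by rewrite /common big_cons capvSr.
  have /eqP eqs : common (l1 :: s) == common s by rewrite eqEdim sub.
  by move: vs; rewrite -eqs /common big_cons memv_cap memv_ker => /andP [/eqP ->].
pose row_fun v : 'rV[K]_(size s) := \row_i tnth (in_tuple s) i v.
have row_lin : linear row_fun.
  by move=> c u v; apply/rowP => i; rewrite !mxE linearP.
have [Phi PhiE] := ex_linfun row_lin.
have Phi0 : lker Phi == 0%VS.
  rewrite -subv0; apply/subvP => v; rewrite memv_ker PhiE => /eqP /rowP v0.
  suff : v \in common s by rewrite s0.
  have {v0} vs l1 : l1 \in s -> l1 v = 0.
    by case/(tnthP (in_tuple s)) => i ->; have := v0 i; rewrite !mxE.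
  rewrite /common big_seq.
  apply: (big_ind (fun W : {vspace V} => v \in W)) => [|U W|l1 l1s].
  - exact: memvf.
  - by rewrite memv_cap => -> ->.
  by rewrite memv_ker vs.
have -> : l = \sum_i l ((Phi^-1)%VF (delta_mx 0 i)) *: tnth (in_tuple s) i.
  apply/lfunP => v; rewrite -{1}(lker0_lfunK Phi0 v) PhiE (row_sum_delta (row_fun v)).
  rewrite !linear_sum sum_lfunE; apply: eq_bigr => i _ /=.
  by rewrite !linearZ /= scale_lfunE mxE [LHS]mulrC.
apply: (big_ind P) => // [l1 l2 P1 P2|i _].
  by rewrite -[l1]scale1r; apply: PL.
by rewrite -[X in P X]addr0; apply: PL => //; apply/sP/mem_tnth.
Qed.

End Functionals.

Section Density.
Variables (K : closedFieldType) (V : vectType K).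
Variables (R : 'End(V) -> Prop) (M : {vspace V}).
Hypothesis R_add : forall D E, R D -> R E -> R (D + E).
Hypothesis R_scale : forall c D, R D -> R (c *: D).
Hypothesis R_comp : forall D E, R D -> R E -> R (D \o E)%VF.
Hypothesis M_stable : forall D z, R D -> z \in M -> D z \in M.
Hypothesis M_cyclic : forall v z, v != 0 -> z \in M -> exists2 D, R D & D v = z.
Hypothesis R_into : exists T, [/\ R T, forall x, T x \in M & exists2 m, m \in M & T m != 0].

(** If T has minimal rank on M among the operators into M that do not
    annihilate M, then T D is a scalar on the image of M for every D, because
    it has an eigenvalue there; as the operators D move a vector of that image
    to every vector of M, the rank is one. *)
Lemma rank_one_exists :
  exists S (r m0 : V),
    [/\ R S, r != 0, m0 \in M, S m0 = r & forall x, exists c, S x = c *: r].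
Proof.
pose C T := [/\ R T, forall x, T x \in M & exists2 m, m \in M & T m != 0].
have [T CT minT] : exists2 T, C T & forall T', C T' -> (\dim (T @: M) <= \dim (T' @: M))%N.
  have exk : exists k, `[< exists2 T, C T & \dim (T @: M) = k >].
    by have [T CT] := R_into; exists (\dim (T @: M)); apply/asboolP; exists T.
  have [k /asboolP [T CT <-] mink] := ex_minnP exk.
  by exists T => // T' CT'; apply: mink; apply/asboolP; exists T'.
have [RT TM [m0 m0M Tm0]] := CT.
pose U := (T @: M)%VS.
have U0 : U != 0%VS.
  by apply: contraNneq Tm0 => U0; rewrite -memv0 -U0 memv_img.
have scalar D : R D -> exists mu, forall m, m \in M -> T (D (T m)) = mu *: T m.
  move=> RD.
  have [mu [r0 r0U [r00 r0E]]] : exists mu, exists2 u, u \in U &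
      u != 0 /\ (T \o D)%VF u = mu *: u.
    apply: closed_eigenvector => // u /memv_imgP [m mM ->].
    by rewrite comp_lfunE memv_img // M_stable.
  (* T1 has smaller rank on M, since T D - mu kills the eigenvector. *)
  exists mu; pose T1 := ((T \o D) \o T - mu *: T)%VF.
  have T1E x : T1 x = T (D (T x)) - mu *: T x.
    by rewrite add_lfunE opp_lfunE scale_lfunE !comp_lfunE.
  have RT1 : R T1.
    by apply: R_add; rewrite -?scaleNr; [do 2?apply: R_comp | apply: R_scale].
  move=> m mM; apply/eqP; rewrite -subr_eq0 -T1E; apply/negP => /negP T1m.
  have CT1 : C T1.
    by split=> [//|x|]; [rewrite T1E rpredB // rpredZ | exists m].
  have := minT _ CT1; rewrite leqNgt => /negP; apply.
  pose f := ((T \o D) - mu *: \1)%VF.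
  have fE x : f x = T (D x) - mu *: x.
    by rewrite add_lfunE opp_lfunE scale_lfunE comp_lfunE id_lfunE.
  have -> : (T1 @: M)%VS = (f @: U)%VS.
    rewrite /U -limg_comp; congr (_ @: _)%VS; apply/lfunP => x.
    by rewrite comp_lfunE T1E fE.
  rewrite -(limg_ker_dim f U) -{1}[\dim (f @: U)]add0n ltn_add2r lt0n dimv_eq0.
  apply/eqP => /vspaceP /(_ r0); rewrite memv_cap memv_ker r0U fE memv0 (negPf r00).
  by move: r0E; rewrite comp_lfunE => ->; rewrite subrr eqxx.
have onM z : z \in M -> exists c, T z = c *: T m0.
  move=> zM; have [D RD Dz] := M_cyclic Tm0 zM.
  by have [mu muE] := scalar D RD; exists mu; rewrite -Dz muE.
have [D RD Dm0] := M_cyclic Tm0 m0M.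
(* T is of rank one on M only; T D T is so on the whole space. *)
exists (T \o (D \o T))%VF, (T m0), m0; split=> //.
- by do 2?apply: R_comp.
- by rewrite !comp_lfunE Dm0.
by move=> x; rewrite !comp_lfunE; apply/onM/M_stable.
Qed.

(** Composing the functional of one operator of rank one with all operators
    yields functionals that separate points, hence all functionals. *)
Lemma rank_one_dense (u : V) (l : 'Hom(V, K^o)) : u \in M ->
  exists2 D, R D & forall v, D v = l v *: u.
Proof.
move=> uM; have [S [r [m0 [RS r0 m0M Sm0 Sr]]]] := rank_one_exists.
have [l0 l0E] : exists l0 : 'Hom(V, K^o), forall v, S v = l0 v *: r.
  have lin : linear (fun v => coord [tuple r] ord0 (S v) : K^o).
    by move=> c x y; rewrite !linearP.
  have [l0 l0E] := ex_linfun lin; exists l0 => v; rewrite l0E.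
  have cr : coord [tuple r] ord0 r = 1.
    have fr : free [tuple r] by rewrite seq1_free.
    exact: (coord_free (ord0 : 'I_1) (ord0 : 'I_1) fr).
  by have [c ->] := Sr v; rewrite linearZ /= cr mulr1.
move: u uM; pose P (l : 'Hom(V, K^o)) := forall u, u \in M ->
  exists2 D, R D & forall v, D v = l v *: u.
apply: (@separating_span _ _ P _ _ _ l) => [u uM|c l1 l2 P1 P2 u uM|v v0].
- exists (0 *: S); first exact: R_scale.
  by move=> v; rewrite !scale_lfunE zero_lfunE !scale0r.
- have [D1 RD1 D1E] := P1 u uM; have [D2 RD2 D2E] := P2 u uM.
  exists (c *: D1 + D2); first by apply: R_add => //; apply: R_scale.
  by move=> v; rewrite !add_lfunE !scale_lfunE D1E D2E scalerDl scalerA.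
have [D RD Dv] := M_cyclic v0 m0M.
exists (l0 \o D)%VF.
  move=> u uM; have [E RE Er] := M_cyclic r0 uM.
  exists (E \o (S \o D))%VF; first by do 2?apply: R_comp.
  by move=> x; rewrite !comp_lfunE l0E linearZ /= Er.
rewrite comp_lfunE Dv; apply: contraNneq r0 => l0m0.
by rewrite -Sm0 l0E l0m0 scale0r.
Qed.

End Density.

(** * Separating the components of a graded prime algebra by polynomials *)

(** A subspace of largest dimension contained in P exhausts P. *)
Lemma subspace_vspace (K : fieldType) (V : vectType K) (P : V -> Prop) :
  P 0 -> (forall c x y, P x -> P y -> P (c *: x + y)) ->
  exists U : {vspace V}, forall x, x \in U <-> P x.
Proof.
move=> P0 PL; pose sub (U : {vspace V}) := forall x, x \in U -> P x.
have exk : exists k, `[< exists2 U, sub U & \dim U = k >].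
  exists 0%N; apply/asboolP; exists 0%VS; last exact: dimv0.
  by move=> x; rewrite memv0 => /eqP ->.
have ubk k : `[< exists2 U, sub U & \dim U = k >] -> (k <= dim V)%N.
  by move=> /asboolP [U _ <-]; rewrite -dimvf; apply: dimvS (subvf _).
have [k /asboolP [U subU <-] maxU] := ex_maxnP exk ubk.
exists U => x; split; first exact: subU.
move=> Px; apply: contrapT => /negP xU.
have : (\dim (<[x]> + U) <= \dim U)%N.
  apply: maxU; apply/asboolP; exists (<[x]> + U)%VS => // y.
  by case/memv_addP => _ /vlineP [c ->] [z zU ->]; apply: PL => //; apply: subU.
rewrite leqNgt ltn_neqAle dimvS ?addvSr // andbT negbK => /eqP eqd.
move: xU; have /eqP -> : (U == <[x]> + U)%VS by rewrite eqEdim addvSr eqd leqnn.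
by rewrite memvE addvSl.
Qed.

Section MinimalIdeal.
Variables (K : closedFieldType) (Omega : signature) (G : semigroupType).
Variable deg0 : Omega 0%N -> G.
Variables A B : fd_graded_alg K deg0.
Variables (n : nat) (e : n.-tuple A) (d : 'I_n -> G).
Hypothesis ed : homogeneous_basis e d.
Hypothesis primeA : graded_prime A.
Local Notation realizable := (realizable B e d).
Local Notation stable := (stable e d).

(** The second condition holds for the compositions of the operators that are
    going to be used, but does not follow from the first. *)
Let mult_op (D : 'End(A)) : Prop :=
  realizable D /\ forall I, stable I -> forall z, z \in I -> D z \in I.

Let mult_op_hproj g : mult_op (hproj e d g).
Proof.
by split=> [|I [sI _] z zI]; [apply: realizable_hproj | apply: sI].
Qed.

Let mult_op_id : mult_op \1%VF.
Proof. by split=> [|I _ z zI]; [apply: realizable_id | rewrite id_lfunE]. Qed.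

Let mult_opD D E : mult_op D -> mult_op E -> mult_op (D + E).
Proof.
move=> [RD sD] [RE sE]; split=> [|I sI z zI]; first exact: realizableD.
by rewrite add_lfunE rpredD ?(sD I) ?(sE I).
Qed.

Let mult_opZ c D : mult_op D -> mult_op (c *: D).
Proof.
move=> [RD sD]; split=> [|I sI z zI]; first exact: realizableZ.
by rewrite scale_lfunE rpredZ ?(sD I).
Qed.

Let mult_op_comp D E : mult_op D -> mult_op E -> mult_op (D \o E)%VF.
Proof.
move=> [RD sD] [RE sE]; split=> [|I sI z zI]; first exact: realizable_comp.
by rewrite comp_lfunE (sD I) ?(sE I).
Qed.

Let mult_op_slot m (w : Omega m) (a : {ffun 'I_m -> A}) i :
  (forall j, homogeneous (a j)) ->
  exists2 D, mult_op D & forall x, D x = omega_op (ga_str A) w (ffun_upd a i x).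
Proof.
move=> ha; have [D DE] := ex_linfun (omega_opP (ga_str A) w a i).
exists D => //; split=> [|I sI z zI]; first exact: (realizable_slot B ed ha DE).
rewrite DE; have [opI _] := stable_graded_ideal ed sI.
by apply: (opI _ _ _ i); rewrite ffunE eqxx.
Qed.

(** A nonzero stable subspace of least dimension is contained in the submodule
    generated by any nonzero vector, since that submodule meets it nontrivially
    by primeness. *)
Lemma minimal_stable : exists M, [/\ stable M, M != 0%VS &
  forall v z, v != 0 -> z \in M -> exists2 D, mult_op D & D v = z].
Proof.
have exk : exists k, `[< exists M, [/\ stable M, M != 0%VS & \dim M = k] >].
  exists (\dim {:A}); apply/asboolP; exists fullv; split=> //.
    by split=> [g v _|m w a i _ _]; rewrite memvf.
  have [[x x0] _] := primeA; apply: contraNneq x0 => full0.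
  by rewrite -memv0 -full0 memvf.
have [k /asboolP [M [sM M0 <-]] minM] := ex_minnP exk.
exists M; split=> // v z v0 zM.
have [|c x y [D RD <-] [E RE <-]|J JP] :=
    @subspace_vspace K A (fun z => exists2 D, mult_op D & D v = z).
- by exists (0 *: \1%VF); [apply: mult_opZ | rewrite scale_lfunE scale0r].
- exists (c *: D + E); last by rewrite add_lfunE scale_lfunE.
  by apply: mult_opD => //; apply: mult_opZ.
have sJ : stable J.
  split=> [g x /JP [D RD <-]|m w a i ha /JP [D RD Dv]].
    apply/JP; exists (hproj e d g \o D)%VF; last by rewrite comp_lfunE.
    exact: mult_op_comp.
  have [E RE EE] := mult_op_slot w i ha.
  apply/JP; exists (E \o D)%VF; first exact: mult_op_comp.
  by rewrite comp_lfunE Dv EE ffun_upd_id.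
have J0 : J != 0%VS.
  apply: contraNneq v0 => J0; rewrite -memv0 -J0.
  by apply/JP; exists \1%VF; rewrite ?id_lfunE.
apply/JP; suff MJ : (M :&: J)%VS = M by move: zM; rewrite -{1}MJ memv_cap => /andP [].
apply/eqP; rewrite eqEdim capvSl; apply: minM; apply/asboolP.
exists (M :&: J)%VS; split=> //.
  case: sM sJ => [pM oM] [pJ oJ]; split=> [g x|m w a i ha].
    by rewrite !memv_cap => /andP [xM xJ]; rewrite pM ?pJ.
  by rewrite !memv_cap => /andP [xM xJ]; rewrite (oM _ _ _ i) ?(oJ _ _ _ i).
have [m [w [i [j [a [_ ha aM aJ wa]]]]]] := prime_stable ed primeA sM sJ M0 J0.
apply: contraNneq wa => MJ0; rewrite -memv0 -MJ0 memv_cap.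
by rewrite (sM.2 _ _ _ i) ?(sJ.2 _ _ _ j).
Qed.

(** Density applies to M because an operation that does not vanish on M, with
    one of its arguments fixed in M, is an operator into M. *)
Lemma minimal_ideal : exists M, [/\ stable M, M != 0%VS,
  forall v z, v != 0 -> z \in M -> exists2 D, realizable D & D v = z &
  forall u (l : 'Hom(A, K^o)), u \in M ->
    exists2 D, realizable D & forall v, D v = l v *: u].
Proof.
have [M [sM M0 cycM]] := minimal_stable.
exists M; split=> // [v z v0 zM|u l uM].
  by have [D [RD _] Dv] := cycM v z v0 zM; exists D.
suff [D [RD _] DE] : exists2 D, mult_op D & forall v, D v = l v *: u by exists D.
apply: (rank_one_dense (M := M)) => // [D z [_ sD] zM|]; first exact: sD.
have [m [w [i [j [a [ij ha aiM ajM wa]]]]]] := prime_stable ed primeA sM sM M0 M0.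
have [T RT TE] := mult_op_slot w i ha; exists T; split=> //.
  move=> x; rewrite TE; have [opM _] := stable_graded_ideal ed sM.
  by apply: (opM _ _ _ j); rewrite ffunE eq_sym (negPf ij).
by exists (a i) => //; rewrite TE ffun_upd_id.
Qed.

Local Notation F := (graded_poly K Omega G).
Local Notation strF := (free_str K Omega (nat * G)%type).

Definition natural_list (r : nat) (T : seq F -> F) : Prop :=
  forall eta : {linear F -> B}, omega_hom strF (ga_str B) eta ->
  exists2 q, multilinear_list r q & forall fs, eta (T fs) = q (map eta fs).

Lemma ffun_updC (C : Type) m (a : {ffun 'I_m -> C}) i j x y : i != j ->
  ffun_upd (ffun_upd a i x) j y = ffun_upd (ffun_upd a j y) i x.
Proof.
move=> ij; apply/ffunP => l; rewrite !ffunE.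
by have [->|//] := eqVneq l j; rewrite eq_sym (negPf ij).
Qed.

(** Products of functionals are values of multilinear polynomials. A new factor
    is attached by an operation that does not vanish on the minimal ideal: one
    of its arguments receives the product built so far and another one the
    next functional, both turned into fixed elements of the ideal. *)
Lemma product_poly : exists2 w : A, w != 0 &
  forall L : seq (G * 'Hom(A, K^o)), exists2 T, natural_list (size L) T &
    forall phi, frame e d phi -> forall fs,
      all2 (fun f p => phi f \in ga_comp A p.1) fs L ->
      phi (T fs) = (\prod_(p <- zip fs L) p.2.2 (phi p.1)) *: w.
Proof.
have [M [sM M0 cycM rk1M]] := minimal_ideal.
have [m [w0 [i [j [a [ij ha aiM ajM wa0]]]]]] := prime_stable ed primeA sM sM M0 M0.
pose w := omega_op (ga_str A) w0 a; exists w => //.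
have [c ac] := choice ha.
have [gw wgw] : exists gw, w \in ga_comp A gw.
  by exists (op_degree deg0 w0 c); apply: op_degree_mem.
elim=> [|[h l] L [T NT TE]].
  exists (fun=> const_poly e d w).
    by move=> eta _; exists (fun=> eta (const_poly e d w)) => // s1 s2; rewrite addnC.
  by move=> phi fphi [|//] _; rewrite (frame_const ed _ fphi) big_nil scale1r.
(* E puts the previous product, a multiple of w, into the argument i, and D puts
   the new functional into the argument j; the value is again a multiple of w. *)
have [E RE Ew] := cycM w (a i) wa0 aiM.
have [D RD DE] := rk1M (a j) l ajM.
have [TE' NE EE'] := RE gw (c i); have [TD ND ED'] := RD h (c j).
pose u : {ffun 'I_m -> F} := [ffun k => const_poly e d (a k)].
exists (fun fs => if fs is f :: fs' then omega_op strF w0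
  (ffun_upd (ffun_upd u i (TE' (T fs'))) j (TD f)) else 0).
  move=> eta etah; have [q qml qE] := NT _ etah.
  have [E' E'lin E'E] := NE _ etah; have [D' D'lin D'E] := ND _ etah.
  pose b : {ffun 'I_m -> B} := [ffun k => eta (u k)].
  exists (fun s => if s is x :: s' then omega_op (ga_str B) w0
    (ffun_upd (ffun_upd b i (E' (q s'))) j (D' x)) else 0); last first.
    case=> [|f fs]; first by rewrite linear0.
    rewrite (hom_upd _ _ _ _ etah) D'E /= -qE -E'E.
    congr (omega_op _ _ (ffun_upd _ _ _)); apply/ffunP => k; rewrite !ffunE.
    by case: eqP.
  move=> [|x s1] s2 /= [sz] k y z; first by rewrite D'lin omega_opP.
  rewrite (qml s1 s2) ?E'lin; last by rewrite -sz addSn.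
  by rewrite !(ffun_updC _ _ _ ij) omega_opP.
move=> phi fphi [|f fs] //= /andP [fh fsL]; rewrite big_cons /=.
rewrite (hom_upd _ _ _ _ fphi.1) (ED' _ fphi _ fh) DE linearZ /= (hproj_id ed (ac j)).
have -> : [ffun k => phi (ffun_upd u i (TE' (T fs)) k)] =
    ffun_upd a i (phi (TE' (T fs))).
  by apply/ffunP => k; rewrite !ffunE; case: eqP => // _; rewrite (frame_const ed _ fphi).
have Tfs := TE _ fphi _ fsL.
rewrite (EE' _ fphi); last by rewrite Tfs rpredZ.
rewrite Tfs linearZ /= Ew linearZ /= (hproj_id ed (ac i)).
rewrite (multilinearZ (omega_opP _ w0)) (ffun_updC _ _ _ ij).
by rewrite (multilinearZ (omega_opP _ w0)) scalerA -(ffun_updC _ _ _ ij) !ffun_upd_id.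
Qed.

End MinimalIdeal.

(** * Transfer of polynomial relations between structure determinants *)

Lemma all2_cat (S T : Type) (r : S -> T -> bool) s1 s2 t1 t2 : size s1 = size t1 ->
  all2 r (s1 ++ s2) (t1 ++ t2) = all2 r s1 t1 && all2 r s2 t2.
Proof. by elim: s1 t1 => [|x s1 IHs] [|y t1] //= [sz]; rewrite IHs // andbA. Qed.

Section GradedAlternation.
Variables (K : fieldType) (G : semigroupType) (n : nat) (d : 'I_n -> G).

(** Only permutations respecting the degrees keep every argument in the place
    of its degree; in a determinant of homogeneous vectors with respect to a
    homogeneous basis the other permutations contribute zero. *)
Definition degree_perm : pred 'S_n := fun s => [forall i, d (s i) == d i].

Definition permuted (C : Type) (z : 'I_n -> C) (s : 'S_n) : seq C :=
  [seq z (s i) | i <- enum 'I_n].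

(** When q is a product of coordinates, this is a product of determinants, one
    for each block of Z. *)
Fixpoint alt_list (C D : lmodType K) (q : seq C -> D) (Z : seq ('I_n -> C)) : D :=
  if Z is z :: Z' then
    \sum_(s | degree_perm s) (-1) ^+ s *: alt_list (fun t => q (permuted z s ++ t)) Z'
  else q [::].

Lemma size_permuted (C : Type) (z : 'I_n -> C) s : size (permuted z s) = n.
Proof. by rewrite size_map size_enum_ord. Qed.

Lemma alt_list_linear (C D : lmodType K) (q q1 q2 : seq C -> D) c Z :
  (forall t, size t = (n * size Z)%N -> q t = c *: q1 t + q2 t) ->
  alt_list q Z = c *: alt_list q1 Z + alt_list q2 Z.
Proof.
elim: Z q q1 q2 => [|z Z IHZ] q q1 q2 qE /=; first by apply: qE; rewrite muln0.
rewrite scaler_sumr -big_split; apply: eq_bigr => s _ /=.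
rewrite (IHZ _ (fun t => q1 (permuted z s ++ t)) (fun t => q2 (permuted z s ++ t))).
  by rewrite scalerDr !scalerA mulrC.
by move=> t tn; apply: qE; rewrite size_cat size_permuted tn mulnS.
Qed.

Lemma map_alt_list (C D C' D' : lmodType K) (eta : C -> C') (xi : {linear D -> D'})
    (q : seq C -> D) (q' : seq C' -> D') Z :
  (forall t, xi (q t) = q' (map eta t)) ->
  xi (alt_list q Z) = alt_list q' [seq (fun i => eta (z i)) | z <- Z].
Proof.
elim: Z q q' => [|z Z IHZ] q q' qq' /=; first by rewrite qq'.
rewrite linear_sum; apply: eq_bigr => s _ /=; rewrite linearZ /=; congr (_ *: _).
by apply: IHZ => t; rewrite qq' map_cat -map_comp.
Qed.

End GradedAlternation.

Section Determinants.
Variables (K : fieldType) (Omega : signature) (G : semigroupType).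
Variable deg0 : Omega 0%N -> G.
Variables (A : fd_graded_alg K deg0) (n : nat) (e : n.-tuple A) (d : 'I_n -> G).
Hypothesis ed : homogeneous_basis e d.

Definition coord_det (z : 'I_n -> A) : K := \det (\matrix_(i, j) coord e j (z i)).

Lemma coord_det_degree_perm z : (forall i, z i \in ga_comp A (d i)) ->
  coord_det z = \sum_(s | degree_perm d s) (-1) ^+ s * \prod_i coord e i (z (s i)).
Proof.
move=> zd; rewrite /coord_det -det_tr /determinant (bigID (degree_perm d)) /=.
rewrite [X in _ + X]big1 ?addr0 => [|s].
  by apply: eq_bigr => s _; congr (_ * _); apply: eq_bigr => i _; rewrite !mxE.
rewrite negb_forall => /existsP [i si]; rewrite (bigD1 i) //= !mxE.
by rewrite (coord_comp ed (zd (s i))) ?mul0r ?mulr0 // eq_sym.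
Qed.

(** The permutations left out of the alternation contribute nothing to the
    determinants, the arguments being homogeneous. *)
Lemma alt_list_coord (lam : 'I_n -> 'Hom(A, K^o)) (C : lmodType K) (phi : C -> A)
    (q : seq C -> A) (w : A) Z :
  (forall i v, lam i v = coord e i v) ->
  (forall z, List.In z Z -> forall i, phi (z i) \in ga_comp A (d i)) ->
  (forall t, all2 (fun f p => phi f \in ga_comp A p.1) t
       (flatten (nseq (size Z) [seq (d i, lam i) | i <- enum 'I_n])) ->
     q t = (\prod_(p <- zip t (flatten (nseq (size Z) [seq (d i, lam i) | i <- enum 'I_n])))
              p.2.2 (phi p.1)) *: w) ->
  alt_list d q Z = (\prod_(z <- Z) coord_det (fun i => phi (z i))) *: w.
Proof.
move=> lamE; elim: Z q w => [|z Z IHZ] q w Zd qE /=.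
  by rewrite qE // !big_nil.
have zd i : phi (z i) \in ga_comp A (d i) by apply: Zd; left.
rewrite big_cons (coord_det_degree_perm zd) mulr_suml scaler_suml.
apply: eq_bigr => s ds; rewrite -!mulrA -[RHS]scalerA; congr (_ *: _).
rewrite mulrC -scalerA.
apply: IHZ => [z' z'Z|t tL]; first by apply: Zd; right.
set L := flatten _ in tL *.
rewrite qE /=; last first.
  rewrite all2_cat ?size_map // tL andbT.
  rewrite /permuted; elim: (enum _) => //= i r ->; rewrite andbT.
  by have /eqP <- := forallP ds i.
rewrite zip_cat ?size_map // big_cat /= scalerA mulrC; congr (_ * _ *: _).
rewrite /permuted -big_enum /=; elim: (enum _) => [|i r IHr]; first by rewrite !big_nil.
by rewrite /= !big_cons IHr lamE.
Qed.

Lemma coord_det_basis : coord_det (tnth e) = 1.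
Proof.
rewrite -(det1 K n); congr determinant; apply/matrixP => i j.
by rewrite !mxE (coord_tnth ed) eq_sym.
Qed.

End Determinants.

Section ListAlternation.
Variables (K : fieldType) (Omega : signature) (G : semigroupType).
Variable deg0 : Omega 0%N -> G.
Variables (B : fd_graded_alg K deg0) (N : nat) (b : N.-tuple B) (db : 'I_N -> G).
Hypothesis bd : homogeneous_basis b db.
Variables (n : nat) (d : 'I_n -> G).

(** Inserting the projections makes the terms of the other permutations vanish,
    which turns the sum into a full alternating sum. *)
Lemma alt_list1 (D : lmodType K) (q : seq B -> D) (z : 'I_n -> B) : multilinear_list n q ->
  (forall i, z i \in ga_comp B (d i)) ->
  alt_list d q [:: z] =
  alt_sum (fun a => q [seq hproj b db (d i) (a i) | i <- enum 'I_n]) z.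
Proof.
move=> qml zd; rewrite /alt_sum (bigID (degree_perm d)) /=.
rewrite [X in _ = _ + X]big1 ?addr0 => [|s].
  apply: eq_bigr => s ds; rewrite cats0; congr (_ *: q _); apply: eq_map => i.
  by have /eqP dsi := forallP ds i; rewrite ffunE -dsi (hproj_id bd (zd _)).
rewrite negb_forall => /existsP [i si].
have ml := multilinear_of_list (p := fun i => hproj b db (d i)) qml
  (fun i => linearP (hproj b db (d i))).
suff -> : q [seq hproj b db (d k) ([ffun k => z (s k)] k) | k <- enum 'I_n] = 0.
  by rewrite scaler0.
rewrite -[RHS](multilinear0 ml [ffun k => z (s k)] i); congr (q _).
apply: eq_map => k; rewrite !ffunE; case: eqP => // ->.
by rewrite linear0 (hproj_other bd (zd (s i)) si).
Qed.

Lemma alt_list1_free (D : lmodType K) (q : seq B -> D) (z : 'I_n -> B) :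
  multilinear_list n q -> (forall i, z i \in ga_comp B (d i)) ->
  alt_list d q [:: z] != 0 -> free [tuple z i | i < n].
Proof.
move=> qml zd; apply: contraNT => nfree.
have ml := multilinear_of_list (p := fun i => hproj b db (d i)) qml
  (fun i => linearP (hproj b db (d i))).
rewrite (alt_list1 qml zd).
have [c [sum0 [i0 ci0]]] : exists c : 'I_n -> K,
    \sum_i c i *: z i = 0 /\ exists i, c i != 0.
  apply: contrapT => no; move/negP: nfree; apply; apply/freeP => c sum0 i.
  apply/eqP/negP => /negP ci; apply: no; exists c; split; last by exists i.
  rewrite -[RHS]sum0; apply: eq_bigr => j _; congr (_ *: _).
  by rewrite -tnth_nth tnth_mktuple.
apply/eqP; apply: (alt_sum_dep (i0 := i0) (c := fun j => - (c i0)^-1 * c j) ml).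
apply: (scalerI ci0); move/eqP: sum0; rewrite (bigD1 i0) //= addr_eq0 => /eqP ->.
rewrite scaler_sumr -sumrN; apply: eq_bigr => j _.
by rewrite scalerA mulrA mulrN divff // mulN1r scaleNr.
Qed.

End ListAlternation.

Section ListAlternationBasis.
Variables (K : fieldType) (Omega : signature) (G : semigroupType).
Variable deg0 : Omega 0%N -> G.
Variables (B : fd_graded_alg K deg0) (n : nat) (b : n.-tuple B) (d : 'I_n -> G).
Hypothesis bd : homogeneous_basis b d.

Lemma alt_list1_det (D : lmodType K) (q : seq B -> D) (z : 'I_n -> B) :
  multilinear_list n q -> (forall i, z i \in ga_comp B (d i)) ->
  alt_list d q [:: z] = coord_det b z *: alt_list d q [:: tnth b].
Proof.
move=> qml zd; rewrite !(alt_list1 bd qml) //; last by move=> i; apply: bd.2.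
have ml := multilinear_of_list (p := fun i => hproj b d (d i)) qml
  (fun i => linearP (hproj b d (d i))).
rewrite -(alt_sum_mul _ _ ml); congr (alt_sum _ _); apply: funext => i.
by rewrite {1}(coord_sum bd (z i)); apply: eq_bigr => j _; rewrite mxE.
Qed.

(** The blocks are reduced to the basis one after the other; each contributes
    its determinant. *)
Lemma alt_list_det (D : lmodType K) (q : seq B -> D) Z :
  multilinear_list (n * size Z) q ->
  (forall z, List.In z Z -> forall i, z i \in ga_comp B (d i)) ->
  alt_list d q Z =
  (\prod_(z <- Z) coord_det b z) *: alt_list d q (nseq (size Z) (tnth b)).
Proof.
elim: Z q => [|z Z IHZ] q qml Zd; first by rewrite big_nil scale1r.
have zd : forall i, z i \in ga_comp B (d i) by apply: Zd; left.
have {}Zd z' : List.In z' Z -> forall i, z' i \in ga_comp B (d i).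
  by move=> z'Z; apply: Zd; right.
rewrite /= in qml; rewrite mulnS in qml.
rewrite big_cons mulrC -scalerA.
pose Q v := alt_list d (fun t => q (v ++ t)) (nseq (size Z) (tnth b)).
have Qml : multilinear_list n Q.
  move=> s1 s2 sz c x y; apply: alt_list_linear => t; rewrite size_nseq => tn.
  by rewrite -!catA /= qml // size_cat addnA -addSn sz tn.
have := alt_list1_det Qml zd; rewrite /= /Q.
under eq_bigr do rewrite cats0. under [in RHS]eq_bigr do rewrite cats0.
move=> <-; rewrite scaler_sumr; apply: eq_bigr => s _.
rewrite IHZ //; last by apply: multilinear_list_cat qml _; rewrite size_permuted.
by rewrite !scalerA mulrC.
Qed.

End ListAlternationBasis.

Section StructureConstants.
Variables (K : fieldType) (Omega : signature) (G : semigroupType).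
Variable deg0 : Omega 0%N -> G.
Variables (n : nat) (d : 'I_n -> G).

(** The indices of the structure constants of a graded algebra with a basis of
    degrees d: sc_row is the number of a basis vector whose coefficient is taken
    in the value of sc_op. Only coefficients that the grading does not force to
    vanish are considered. *)
Record sc_place := ScPlace {
  sc_row : 'I_n;
  sc_arity : nat;
  sc_op : Omega sc_arity;
  sc_arg : {ffun 'I_sc_arity -> 'I_n};
  sc_degree : op_degree deg0 sc_op (fun j => d (sc_arg j)) = d sc_row
}.

(** By the rule of Cramer, the determinants of these families are the structure
    constants multiplied by the determinant of x, which is the one for None. *)
Definition sc_family (C : lmodType K) (sC : omega_str Omega C)
    (k : option sc_place) (x : 'I_n -> C) : 'I_n -> C :=
  if k is Some p then
    fun i => if i == sc_row p
             then omega_op sC (sc_op p) [ffun j => x (sc_arg p j)] else x i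
  else x.

Lemma sc_family_hom (C D : lmodType K) (sC : omega_str Omega C) (sD : omega_str Omega D)
    (phi : {linear C -> D}) k (x : 'I_n -> C) i : omega_hom sC sD phi ->
  phi (sc_family sC k x i) = sc_family sD k (fun i => phi (x i)) i.
Proof.
move=> phom; case: k => [p|] //=; case: eqP => // _; rewrite phom.
by congr (omega_op _ _ _); apply/ffunP => j; rewrite !ffunE.
Qed.

Lemma sc_family_degree (C : fd_graded_alg K deg0) k (x : 'I_n -> C) :
  (forall i, x i \in ga_comp C (d i)) ->
  forall i, sc_family (ga_str C) k x i \in ga_comp C (d i).
Proof.
move=> xd i; case: k => [p|] //=; case: eqP => // ->.
by rewrite -sc_degree; apply: op_degree_mem => j; rewrite ffunE.
Qed.

Definition sc_det (C : fd_graded_alg K deg0) (e : n.-tuple C) (k : option sc_place)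
  (x : 'I_n -> C) : K := coord_det e (sc_family (ga_str C) k x).

End StructureConstants.

Section Transfer.
Variables (K : closedFieldType) (Omega : signature) (G : semigroupType).
Variable deg0 : Omega 0%N -> G.
Variables A B : fd_graded_alg K deg0.
Variables (n : nat) (e : n.-tuple A) (d : 'I_n -> G).
Hypothesis ed : homogeneous_basis e d.
Hypothesis primeA : graded_prime A.
Hypothesis idBA : forall f : graded_poly K Omega G,
  graded_identity B f -> graded_identity A f.
Local Notation F := (graded_poly K Omega G).
Local Notation strF := (free_str K Omega (nat * G)%type).
Local Notation place := (option (sc_place deg0 d)).

(** Letters whose degree does not match their index are sent to 0, which lies
    in every component. *)
Let assignment (x : 'I_n -> A) (p : nat * G) : A :=
  if insub p.1 is Some i then (if p.2 == d i then x i else 0)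
  else if insub (p.1 - n)%N is Some i then (if p.2 == d i then tnth e i else 0)
  else 0.

Lemma frame_exists (x : 'I_n -> A) : (forall i, x i \in ga_comp A (d i)) ->
  exists phi : {linear F -> A}, [/\ frame e d phi,
    forall k g, phi (graded_var K Omega k g) \in ga_comp A g &
    forall i : 'I_n, phi (graded_var K Omega i (d i)) = x i].
Proof.
move=> xd; have [phi [phom phiE]] := free_eval_exists (ga_str A) (assignment x).
exists phi; split.
- split=> // i; rewrite phiE /assignment /=.
  by rewrite insubF ?ltnNge ?leq_addr // addKn valK eqxx.
- move=> k g; rewrite phiE /assignment /=.
  case: insubP => [i _ _|_].
    by case: eqP => [->|_]; rewrite ?xd // mem0v.
  case: insubP => [i _ _|_]; last exact: mem0v.
  by case: eqP => [->|_]; [apply: ed.2 | apply: mem0v].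
by move=> i; rewrite phiE /assignment /= valK eqxx.
Qed.

(** A homogeneous form in the structure determinants, times a fixed nonzero
    vector, is the value of a polynomial. If the form does not vanish on A, the
    polynomial is not an identity of A, hence not one of B. *)
Lemma transfer_alt_list (N : nat) (J : eqType) (r : seq J) (c : J -> K)
    (l : J -> seq place) (x : 'I_n -> A) :
  (forall j, j \in r -> size (l j) = N) ->
  (forall i, x i \in ga_comp A (d i)) ->
  \sum_(j <- r) c j * \prod_(k <- l j) sc_det e k x != 0 ->
  exists (y : 'I_n -> B) (q : seq B -> B), [/\ forall i, y i \in ga_comp B (d i),
    multilinear_list (n * N) q &
    \sum_(j <- r) c j *: alt_list d q [seq sc_family (ga_str B) k y | k <- l j] != 0].
Proof.
move=> lN xd nz.
have lin_coord i : linear (fun v => coord e i v : K^o) by move=> a u v; rewrite linearP.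
have [lam lamE] := choice (fun i => ex_linfun (lin_coord i)).
pose L := flatten (nseq N [seq (d i, lam i) | i <- enum 'I_n]).
have sizeL : size L = (n * N)%N.
  by rewrite size_flatten /shape map_nseq sumn_nseq size_map size_enum_ord.
have [w w0 /(_ L) [T NT TE]] := product_poly B ed primeA; rewrite sizeL in NT.
pose X (i : 'I_n) : F := graded_var K Omega i (d i).
pose f : F := \sum_(j <- r) c j *: alt_list d T [seq sc_family strF k X | k <- l j].
have [phi [fphi phigr phiX]] := frame_exists xd.
have phi_f : phi f != 0.
  have -> : phi f = (\sum_(j <- r) c j * \prod_(k <- l j) sc_det e k x) *: w.
    rewrite linear_sum scaler_suml !big_seq; apply: eq_bigr => j jr /=.
    rewrite linearZ -scalerA /=; congr (_ *: _).
    pose q t := phi (T t); set Z := map _ _.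
    have ZN : size Z = N by rewrite size_map lN.
    rewrite (@map_alt_list _ _ _ d _ _ _ _ id phi T q) => [|t]; last by rewrite map_id.
    rewrite map_id (alt_list_coord (phi := phi) (w := w) ed lamE).
    - rewrite big_map; congr (_ *: _); apply: eq_bigr => k _.
      congr (coord_det e _); apply: funext => i.
      rewrite (sc_family_hom _ _ _ fphi.1); congr (sc_family _ _ _ i).
      exact: funext.
    - move=> z /List.in_map_iff [k [<- _]] i.
      rewrite (sc_family_hom _ _ _ fphi.1); apply: sc_family_degree => i'.
      by rewrite phiX.
    by rewrite ZN; apply: TE.
  by rewrite scaler_eq0 negb_or nz.
have [eta [etahom etagr eta_f]] : exists eta : {linear F -> B},
    [/\ omega_hom strF (ga_str B) eta,
        forall k g, eta (graded_var K Omega k g) \in ga_comp B g & eta f != 0].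
  apply: contrapT => no; move/negP: phi_f; apply; apply/eqP.
  apply: idBA fphi.1 phigr => eta etahom etagr; apply/eqP/negP => /negP eta_f.
  by apply: no; exists eta.
have [q qml qE] := NT _ etahom.
exists (fun i => eta (X i)), q; split=> // [i|]; first exact: etagr.
move: eta_f; rewrite linear_sum /=; congr (_ != 0); apply: eq_bigr => j _.
rewrite linearZ /= (@map_alt_list _ _ _ d _ _ _ _ eta eta T q _ qE) -map_comp.
congr (_ *: alt_list d q _); apply: eq_map => k /=; apply: funext => i.
exact: sc_family_hom.
Qed.

(** The form is the determinant itself. It is not zero at the basis of A, and
    on B a nonzero value of an alternating map requires independent arguments. *)
Lemma transfer_free :
  exists2 y : 'I_n -> B, forall i, y i \in ga_comp B (d i) & free [tuple y i | i < n].
Proof.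
have [| | |y [q [yd qml nz]]] := @transfer_alt_list 1 unit [:: tt]
  (fun=> 1) (fun=> [:: None]) (tnth e).
- by [].
- exact: ed.2.
- by rewrite !big_seq1 mul1r /sc_det /= (coord_det_basis ed) oner_eq0.
exists y => //; have [nB [eB [dB eBd]]] := homogeneous_basis_exists B.
rewrite muln1 in qml; apply: (alt_list1_free eBd qml yd).
by move: nz; rewrite big_seq1 scale1r.
Qed.

Lemma transfer_det (e' : n.-tuple B) (N : nat) (J : eqType) (r : seq J) (c : J -> K)
    (l : J -> seq place) (x : 'I_n -> A) :
  homogeneous_basis e' d ->
  (forall j, j \in r -> size (l j) = N) ->
  (forall i, x i \in ga_comp A (d i)) ->
  \sum_(j <- r) c j * \prod_(k <- l j) sc_det e k x != 0 ->
  exists2 y : 'I_n -> B, forall i, y i \in ga_comp B (d i) &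
    \sum_(j <- r) c j * \prod_(k <- l j) sc_det e' k y != 0.
Proof.
move=> e'd lN xd nz; have [y [q [yd qml]]] := transfer_alt_list lN xd nz.
move=> nzB; exists y => //; apply: contraNneq nzB => sum0.
rewrite (_ : \sum_(j <- r) _ = (\sum_(j <- r) c j * \prod_(k <- l j) sc_det e' k y) *:
    alt_list d q (nseq N (tnth e'))).
  by rewrite sum0 scale0r.
rewrite scaler_suml !big_seq; apply: eq_bigr => j jr; rewrite -scalerA; congr (_ *: _).
rewrite (alt_list_det e'd) ?size_map ?lN // ?big_map //.
by move=> z /List.in_map_iff [k [<- _]] i; apply: sc_family_degree.
Qed.

End Transfer.

(** * Noetherian rings *)

Section Noetherian.

Definition ideal_pred (R : comNzRingType) (I : R -> Prop) : Prop :=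
  [/\ I 0, forall x y, I x -> I y -> I (x + y) & forall c x, I x -> I (c * x)].

Definition ideal_gen (R : comNzRingType) (s : seq R) (x : R) : Prop :=
  forall I, ideal_pred I -> (forall y, y \in s -> I y) -> I x.

Definition noetherian (R : comNzRingType) : Prop :=
  forall I : R -> Prop, ideal_pred I ->
  exists2 s, (forall y, y \in s -> I y) & forall x, I x -> ideal_gen s x.

Lemma ideal_gen_ideal (R : comNzRingType) (s : seq R) : ideal_pred (ideal_gen s).
Proof.
split=> [I [] //|x y gx gy I iI sI|c x gx I iI sI]; have [_ ID IM] := iI.
  by apply: ID; [apply: gx | apply: gy].
by apply: IM; apply: gx.
Qed.

Lemma ideal_gen_mem (R : comNzRingType) (s : seq R) x : x \in s -> ideal_gen s x.
Proof. by move=> xs I _; apply. Qed.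

Lemma ideal_gen_sub (R : comNzRingType) (s t : seq R) x :
  {subset s <= t} -> ideal_gen s x -> ideal_gen t x.
Proof. by move=> st gx I iI tI; apply: gx => // y /st; apply: tI. Qed.

Lemma ideal_predB (R : comNzRingType) (I : R -> Prop) x y :
  ideal_pred I -> I x -> I y -> I (x - y).
Proof. by case=> _ ID IM Ix Iy; apply: ID => //; rewrite -mulN1r; apply: IM. Qed.

Lemma noetherian_field (K : fieldType) : noetherian K.
Proof.
move=> I [I0 _ IM]; have [[x Ix x0]|no] := pselect (exists2 x, I x & x != 0).
  exists [:: x] => [y|y _ J [_ _ JM] xJ]; first by rewrite inE => /eqP ->.
  by rewrite -[y](mulfVK x0); apply/JM/xJ; rewrite inE.
exists [::] => // x Ix J [J0 _ _] _.
by have [->//|x0] := eqVneq x 0; case: no; exists x.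
Qed.

Lemma noetherian_surj (R S : comNzRingType) (f : {rmorphism R -> S}) :
  (forall y, exists x, f x = y) -> noetherian R -> noetherian S.
Proof.
move=> fsurj nR I [I0 ID IM].
have preim J : ideal_pred J -> ideal_pred (fun x => J (f x)).
  case=> J0 JD JM; split=> [|x y Jx Jy|c x Jx]; first by rewrite rmorph0.
    by rewrite rmorphD; apply: JD.
  by rewrite rmorphM; apply: JM.
have [s sI Igen] := nR _ (preim I (And3 I0 ID IM)).
exists (map f s) => [y /mapP [x xs ->]|y Iy J iJ sJ]; first exact: sI.
have [x fx] := fsurj y; rewrite -fx in Iy *.
by apply: (Igen x Iy _ (preim J iJ)) => z zs; apply/sJ/map_f.
Qed.

(** Powers of the variable bring all generators to the degree d, so that the
    coefficients in degree d of the elements of the ideal of size at most d + 1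
    form an ideal containing the prescribed coefficients. *)
Lemma coef_lift (R : comNzRingType) (T : seq (nat * {poly R})) (d : nat) (p : {poly R}) :
  (forall t, t \in T -> (t.1 <= d)%N /\ (size t.2 <= t.1.+1)%N) ->
  ideal_gen [seq t.2`_t.1 | t : nat * {poly R} <- T] p`_d ->
  exists q, [/\ ideal_gen (map snd T) q, (size q <= d.+1)%N & q`_d = p`_d].
Proof.
move=> TP /(_ (fun a => exists q, [/\ ideal_gen (map snd T) q,
  (size q <= d.+1)%N & q`_d = a])); apply => [|_ /mapP [t tT ->]].
  have [g0 gD gM] := ideal_gen_ideal (map snd T).
  split=> [|x y [q [gq sq <-]] [r [gr sr <-]]|c x [q [gq sq <-]]].
  - by exists 0; rewrite size_poly0 coef0.
  - exists (q + r); rewrite coefD; split=> //; first exact: gD.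
    by rewrite (leq_trans (size_polyD _ _)) // geq_max sq.
  exists (c%:P * q); rewrite coefCM; split=> //; first exact: gM.
  by rewrite mul_polyC (leq_trans (size_scale_leq _ _)).
have [td st] := TP t tT; exists ('X^(d - t.1) * t.2); split.
- have [_ _ gM] := ideal_gen_ideal (map snd T); apply: gM.
  by apply: ideal_gen_mem; apply/mapP; exists t.
- rewrite (leq_trans (size_polyMleq _ _)) // size_polyXn /= -[d in (_ <= d.+1)%N](subnK td).
  by rewrite -addnS leq_add2l.
by rewrite coefXnM ltnNge leq_subr /= subKn.
Qed.

(** The basis theorem of Hilbert: an ideal of polynomials is generated by lifts
    of generators of the ideal of its leading coefficients, which take care of
    the high degrees, together with lifts of generators of the finitely many
    ideals of leading coefficients in low degrees. *)
Lemma noetherian_poly (R : comNzRingType) : noetherian R -> noetherian {poly R}.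
Proof.
move=> nR I [I0 ID IM]; have iI : ideal_pred I by [].
have lift (J : R -> Prop) : ideal_pred J ->
    (forall a, J a -> exists t : nat * {poly R},
       [/\ I t.2, (size t.2 <= t.1.+1)%N & t.2`_t.1 = a]) ->
    exists T : seq (nat * {poly R}),
      (forall t, t \in T -> I t.2 /\ (size t.2 <= t.1.+1)%N) /\
      forall a, J a -> ideal_gen [seq t.2`_t.1 | t : nat * {poly R} <- T] a.
  move=> iJ liftJ; have [s sJ Jgen] := nR J iJ.
  have [T TP Ts] : exists2 T : seq (nat * {poly R}),
      forall t, t \in T -> I t.2 /\ (size t.2 <= t.1.+1)%N &
      [seq t.2`_t.1 | t : nat * {poly R} <- T] = s.
    elim: s sJ {Jgen} => [|a s IHs] sJ; first by exists [::].
    have [|T TP <-] := IHs; first by move=> y ys; apply: sJ; rewrite inE ys orbT.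
    have [|t [It st ta]] := liftJ a; first by apply: sJ; rewrite inE eqxx.
    exists (t :: T); last by rewrite /= ta.
    by move=> u; rewrite inE => /predU1P [->|/TP].
  by exists T; split=> // a /Jgen; rewrite Ts.
(* J is the ideal of leading coefficients in all degrees. *)
pose J a := exists d p, [/\ I p, (size p <= d.+1)%N & p`_d = a].
have iJ : ideal_pred J.
  split=> [|x y [d [p [Ip sp <-]]] [d' [p' [Ip' sp' <-]]]|c x [d [p [Ip sp <-]]]].
  - by exists 0%N, 0; rewrite size_poly0 coef0.
  - have shift k (r : {poly R}) : (size ('X^k * r)%R <= k + size r)%N.
      by rewrite (leq_trans (size_polyMleq _ _)) // size_polyXn.
    exists (d + d')%N, ('X^d' * p + 'X^d * p'); split.
    + by apply: ID; apply: IM.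
    + rewrite (leq_trans (size_polyD _ _)) // geq_max.
      rewrite (leq_trans (shift _ _)) ?(leq_trans (shift _ _)) //; last first.
        by rewrite addnC -addSn leq_add2r.
      by rewrite -addnS leq_add2l.
    by rewrite coefD !coefXnM !ltnNge leq_addl leq_addr /= addnK addKn.
  exists d, (c%:P * p); rewrite coefCM; split=> //; first exact: IM.
  by rewrite mul_polyC (leq_trans (size_scale_leq _ _)).
have [|T [TP Tgen]] := lift J iJ.
  by move=> a [d [p [Ip sp <-]]]; exists (d, p).
pose D := \max_(t <- T) t.1.
have TD t : t \in T -> (t.1 <= D)%N.
  by move=> tT; rewrite /D (big_rem t) //= leq_maxl.
(* The degrees less than D, one at a time. *)
have low d : exists2 s, (forall y, y \in s -> I y) &
    forall p, I p -> (size p <= d)%N -> ideal_gen s p.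
  elim: d => [|d [s sI sgen]].
    exists [::] => // p _; rewrite leqn0 size_poly_eq0 => /eqP ->.
    by have [] := ideal_gen_ideal (Nil {poly R}).
  pose Jd a := exists p, [/\ I p, (size p <= d.+1)%N & p`_d = a].
  have iJd : ideal_pred Jd.
    split=> [|x y [p [Ip sp <-]] [p' [Ip' sp' <-]]|c x [p [Ip sp <-]]].
    - by exists 0; rewrite size_poly0 coef0.
    - exists (p + p'); rewrite coefD; split=> //; first exact: ID.
      by rewrite (leq_trans (size_polyD _ _)) // geq_max sp.
    exists (c%:P * p); rewrite coefCM; split=> //; first exact: IM.
    by rewrite mul_polyC (leq_trans (size_scale_leq _ _)).
  have [s' s'J Jgen] := nR Jd iJd.
  have [P PE] : exists P : R -> {poly R}, forall a, Jd a ->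
      [/\ I (P a), (size (P a) <= d.+1)%N & (P a)`_d = a].
    suff : forall a, exists p, Jd a -> [/\ I p, (size p <= d.+1)%N & p`_d = a].
      by move=> /choice [P PE]; exists P.
    by move=> a; have [[p pP]|no] := pselect (Jd a); [exists p | exists 0].
  exists (s ++ [seq P a | a <- s']) => [y|p Ip sp].
    by rewrite mem_cat => /orP [/sI //|/mapP [a /s'J /PE [Ia _ _] ->]].
  have [||q [gq sq qd]] := @coef_lift R [seq (d, P a) | a <- s'] d p.
  - by move=> _ /mapP [a /s'J /PE [_ sa _] ->].
  - rewrite -map_comp (_ : map _ s' = s'); first by apply: Jgen; exists p.
    by rewrite -[RHS]map_id; apply/eq_in_map => a /s'J /PE [].
  rewrite -map_comp in gq.
  rewrite -(subrK q p); have [_ gD _] := ideal_gen_ideal (s ++ [seq P a | a <- s']).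
  apply: gD; last first.
    by apply: ideal_gen_sub gq => y ys; rewrite mem_cat ys orbT.
  apply: (@ideal_gen_sub _ s) => [y ys|]; first by rewrite mem_cat ys.
  apply: sgen; first apply: ideal_predB => //.
    by apply: gq => // y /mapP [a /s'J /PE [Ia _ _] ->].
  apply/leq_sizeP => k; rewrite leq_eqVlt => /orP [/eqP <-|dk].
    by rewrite coefB qd subrr.
  by rewrite coefB !nth_default ?subrr // (leq_trans _ dk).
have [s sI sgen] := low D.
exists (s ++ map snd T) => [y|p Ip].
  by rewrite mem_cat => /orP [/sI //|/mapP [t /TP [It _] ->]].
have [_ gD _] := ideal_gen_ideal (s ++ map snd T).
have [k] := ubnP (size p); elim: k p Ip => // k IHk p Ip; rewrite ltnS => pk.
have [pD|Dp] := leqP (size p) D.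
  by apply: ideal_gen_sub (sgen p Ip pD) => y ys; rewrite mem_cat ys.
case sp : (size p) => [|d]; first by rewrite sp in Dp.
have [||q [gq sq qd]] := @coef_lift R T d p.
- by move=> t tT; rewrite (TP t tT).2 (leq_trans (TD t tT)) // -ltnS -sp.
- by apply: Tgen; exists d, p; rewrite sp.
rewrite -(subrK q p); apply: gD; last first.
  by apply: ideal_gen_sub gq => y ys; rewrite mem_cat ys orbT.
apply: IHk.
  by apply: ideal_predB => //; apply: gq => // y /mapP [t /TP [It _] ->].
apply: leq_ltn_trans (_ : d < k)%N; last by rewrite -sp.
apply/leq_sizeP => j; rewrite leq_eqVlt => /orP [/eqP <-|dj].
  by rewrite coefB qd subrr.
by rewrite coefB !nth_default ?subrr // ?sp (leq_trans _ dj).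
Qed.

End Noetherian.
Import mpoly.

(** * Polynomial maps and elimination *)

Section PolynomialFunctions.

Lemma mpoly_ring_ind (R : comNzRingType) n (P : {mpoly R[n]} -> Prop) :
  (forall c, P c%:MP) -> (forall i, P 'X_i) ->
  (forall p q, P p -> P q -> P (p + q)) -> (forall p q, P p -> P q -> P (p * q)) ->
  forall p, P p.
Proof.
move=> PC PX PD PM p.
have P0 : P 0 by rewrite -mpolyC0.
have P1 : P 1 by rewrite -mpolyC1.
rewrite [p]mpolyE; apply: (big_ind P) => // m _.
rewrite -mul_mpolyC; apply: (PM) => //; rewrite mpolyXE_id.
apply: (big_ind P) => // i _; elim: (m i) => [|k IHk]; first by rewrite expr0.
by rewrite exprS; apply: PM.
Qed.

Lemma noetherian_mpoly (K : fieldType) n : noetherian {mpoly K[n]}.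
Proof.
elim: n => [|n IHn].
  apply: (noetherian_surj (f := @mpolyC 0 K) _ (@noetherian_field K)) => p.
  by exists p@_0%MM; apply: esym; apply: nvar0_mpolyC.
(* The last variable is substituted for the variable of the univariate ring. *)
pose f : {rmorphism {poly {mpoly K[n]}} -> {mpoly K[n.+1]}} :=
  horner_eval 'X_ord_max \o map_poly (@mwiden n K).
apply: (noetherian_surj (f := f) _ (@noetherian_poly _ IHn)).
apply: mpoly_ring_ind => [c|i|p q [x <-] [y <-]|p q [x <-] [y <-]].
- by exists (c%:MP)%:P; rewrite /= map_polyC /horner_eval hornerC /= mwidenC.
- have [j ->|->] := unliftP ord_max i.
    exists ('X_j)%:P; rewrite /= map_polyC /horner_eval hornerC /= mwidenX.
    by rewrite mnmwiden1; congr 'X_(_); apply: val_inj => /=; rewrite /bump leqNgt ltn_ord.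
  by exists 'X; rewrite /= map_polyX /horner_eval hornerX.
- by exists (x + y); rewrite rmorphD.
by exists (x * y); rewrite rmorphM.
Qed.

(** The ideal generated by the family has finitely many generators, each of
    which involves finitely many members of the family. *)
Lemma zeros_finite (K : fieldType) n (I : Type) (F : I -> {mpoly K[n]}) :
  exists s : seq I, forall v, (forall i, List.In i s -> (F i).@[v] = 0) ->
  forall i, (F i).@[v] = 0.
Proof.
pose J p := exists s : seq I, ideal_gen [seq F i | i <- s] p.
have iJ : ideal_pred J.
  split=> [|p q [s sp] [t tq]|c p [s sp]].
  - by exists [::]; have [] := ideal_gen_ideal (Nil {mpoly K[n]}).
  - exists (s ++ t); rewrite map_cat.
    have [_ gD _] := ideal_gen_ideal ([seq F i | i <- s] ++ [seq F i | i <- t]).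
    by apply: gD; [apply: ideal_gen_sub sp | apply: ideal_gen_sub tq] => r rs;
      rewrite mem_cat rs ?orbT.
  by exists s; have [_ _ gM] := ideal_gen_ideal [seq F i | i <- s]; apply: gM.
have [ps psJ psgen] := noetherian_mpoly iJ.
have [s sps] : exists s : seq I, forall p, p \in ps -> ideal_gen [seq F i | i <- s] p.
  elim: ps psJ {psgen} => [|p ps IHps] psJ; first by exists [::].
  have [|s sps] := IHps; first by move=> q qs; apply: psJ; rewrite inE qs orbT.
  have [|t tp] := psJ p; first by rewrite inE eqxx.
  exists (t ++ s) => q; rewrite inE map_cat => /predU1P [->|/sps qs].
    by apply: ideal_gen_sub tp => r rs; rewrite mem_cat rs.
  by apply: ideal_gen_sub qs => r rs; rewrite mem_cat rs orbT.
exists s => v sv i.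
pose Z p := p.@[v] = 0.
have iZ : ideal_pred Z.
  by split=> [|p q|c p]; rewrite /Z ?meval0 // ?mevalD ?mevalM => ->
    ; rewrite ?mulr0 // add0r.
have Fi : J (F i) by exists [:: i]; apply: ideal_gen_mem; rewrite /= inE.
apply: (psgen _ Fi Z iZ) => p /sps /(_ Z iZ); apply.
elim: s sv {sps} => // j s IHs sv q; rewrite inE => /predU1P [->|qs].
  by apply: sv; left.
by apply: IHs qs => k ks; apply: sv; right.
Qed.

Lemma meval_line (K : fieldType) n (p : {mpoly K[n]}) (x y : 'I_n -> K) :
  exists P : {poly K}, forall t, P.[t] = p.@[fun i => x i + (y i - x i) * t].
Proof.
elim/mpoly_ring_ind: p => [c|i|p q [P PE] [Q QE]|p q [P PE] [Q QE]].
- by exists c%:P => t; rewrite hornerC mevalC.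
- by exists ((x i)%:P + (y i - x i)%:P * 'X) => t; rewrite !hornerE mevalXU.
- by exists (P + Q) => t; rewrite hornerD mevalD PE QE.
by exists (P * Q) => t; rewrite hornerM mevalM PE QE.
Qed.

(** The affine space over an infinite field is irreducible: restrict to the line
    through a point where the first polynomial does not vanish and one where the
    second does not. *)
Lemma nonvanishingM (K : closedFieldType) n (p q : {mpoly K[n]}) x y :
  p.@[x] != 0 -> q.@[y] != 0 -> exists v, (p * q).@[v] != 0.
Proof.
have [P PE] := meval_line p x y; have [Q QE] := meval_line q x y => px qy.
have P0 : P != 0.
  apply: contraNneq px => P0; have := PE 0; rewrite P0 horner0 => ->.
  by apply/eqP/meval_eq => i; rewrite mulr0 addr0.
have Q0 : Q != 0.
  apply: contraNneq qy => Q0; have := QE 1; rewrite Q0 horner0 => ->.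
  by apply/eqP/meval_eq => i; rewrite mulr1 addrC subrK.
have /closed_nonrootP [t] : P * Q != 0 by rewrite mulf_neq0.
rewrite /root hornerM PE QE -mevalM => v0.
by exists (fun i => x i + (y i - x i) * t).
Qed.

Lemma nonvanishing_prod (K : closedFieldType) n (s : seq {mpoly K[n]}) :
  (forall p, p \in s -> exists x, p.@[x] != 0) -> exists v, (\prod_(p <- s) p).@[v] != 0.
Proof.
elim: s => [_|p s IHs sn]; first by exists (fun=> 0); rewrite big_nil meval1 oner_eq0.
have [x px] := sn p (mem_head _ _).
have [|y sy] := IHs; first by move=> q qs; apply: sn; rewrite inE qs orbT.
by rewrite big_cons; apply: nonvanishingM px sy.
Qed.

End PolynomialFunctions.

Section Elimination.
Variable K : closedFieldType.

Lemma mpoly_term n (k : nat) (p : {mpoly K[n]}) :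
  exists2 t : GRing.term K, GRing.rterm t &
    forall e : seq K, GRing.eval e t = p.@[fun i => e`_(k + i)].
Proof.
elim/mpoly_ring_ind: p => [c|i|p q [t rt tE] [u ru uE]|p q [t rt tE] [u ru uE]].
- by exists (GRing.Const c) => // e; rewrite mevalC.
- by exists (GRing.Var K (k + i)) => // e; rewrite mevalXU.
- by exists (GRing.Add t u) => [|e] /=; [rewrite rt ru | rewrite mevalD tE uE].
by exists (GRing.Mul t u) => [|e] /=; [rewrite rt ru | rewrite mevalM tE uE].
Qed.

Lemma term_mpoly n (t : GRing.term K) : GRing.rterm t ->
  exists p : {mpoly K[n]}, forall y : 'I_n -> K,
    GRing.eval [seq y i | i <- enum 'I_n] t = p.@[y].
Proof.
elim: t => //=.
- move=> k _; case: (ltnP k n) => kn.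
    exists 'X_(Ordinal kn) => y; rewrite mevalXU (nth_map (Ordinal kn)) ?size_enum_ord //.
    by congr y; apply: val_inj; rewrite /= nth_enum_ord.
  by exists 0 => y; rewrite meval0 nth_default // size_map size_enum_ord.
- by move=> c _; exists c%:MP => y; rewrite mevalC.
- by move=> k _; exists (k%:R)%:MP => y; rewrite mevalC.
- move=> t IHt u IHu /andP [/IHt [p pE] /IHu [q qE]].
  by exists (p + q) => y; rewrite pE qE mevalD.
- by move=> t IHt /IHt [p pE]; exists (- p) => y; rewrite pE mevalN.
- by move=> t IHt k /IHt [p pE]; exists (p *+ k) => y; rewrite pE mevalMn.
- move=> t IHt u IHu /andP [/IHt [p pE] /IHu [q qE]].
  by exists (p * q) => y; rewrite pE qE mevalM.
by move=> t IHt k /IHt [p pE]; exists (p ^+ k) => y; rewrite pE rmorphXn.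
Qed.

Lemma terms_mpoly n (ts : seq (GRing.term K)) : all (@GRing.rterm K) ts ->
  exists ps : seq {mpoly K[n]}, forall (a : pred K) (y : 'I_n -> K),
    all (fun t => a (GRing.eval [seq y i | i <- enum 'I_n] t)) ts =
    all (fun p => a p.@[y]) ps.
Proof.
elim: ts => [_|t ts IHts /= /andP [/(@term_mpoly n) [p pE] /IHts [ps psE]]].
  by exists [::].
by exists (p :: ps) => a y; rewrite /= pE psE.
Qed.

Lemma dnf_eval (bcs : seq (seq (GRing.term K) * seq (GRing.term K))) (e : seq K) :
  GRing.qf_eval e (GRing.dnf_to_form bcs) =
  has (fun bc => all (fun t => GRing.eval e t == 0) bc.1 &&
                 all (fun t => GRing.eval e t != 0) bc.2) bcs.
Proof.
elim: bcs => //= [[ps qs] bcs ->] /=; congr ((_ && _) || _).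
  by elim: ps => //= t ts ->.
by elim: qs => //= t ts ->.
Qed.

Definition in_piece n (c : seq {mpoly K[n]} * seq {mpoly K[n]}) (y : 'I_n -> K) : bool :=
  all (fun p => p.@[y] == 0) c.1 && all (fun p => p.@[y] != 0) c.2.

Lemma dnf_mpoly n (bcs : seq (seq (GRing.term K) * seq (GRing.term K))) :
  all (@GRing.dnf_rterm _) bcs ->
  exists cs : seq (seq {mpoly K[n]} * seq {mpoly K[n]}), forall y : 'I_n -> K,
    GRing.qf_eval [seq y i | i <- enum 'I_n] (GRing.dnf_to_form bcs) =
    has (fun c => in_piece c y) cs.
Proof.
elim: bcs => [_|[ts us] bcs IHbcs /andP [/andP [rts rus] /IHbcs [cs csE]]].
  by exists [::].
have [ps psE] := terms_mpoly n rts; have [qs qsE] := terms_mpoly n rus.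
exists ((ps, qs) :: cs) => y; have := csE y; rewrite !dnf_eval /= => ->.
congr (_ && _ || _); first exact: (psE (fun x => x == 0)).
exact: (qsE (fun x => x != 0)).
Qed.

Definition in_image n m (s : 'I_n -> {mpoly K[m]}) (y : 'I_n -> K) : Prop :=
  exists v, forall i, y i = (s i).@[v].

(** Membership in the image is an existential formula, and the elimination of its
    quantifiers leaves a disjunction of systems of equations and inequations. *)
Lemma image_constructible n m (s : 'I_n -> {mpoly K[m]}) :
  exists cs, forall y, in_image s y <-> has (fun c => in_piece c y) cs.
Proof.
have [t tP] : exists t : 'I_n -> GRing.term K, forall i, GRing.rterm (t i) /\
    forall e : seq K, GRing.eval e (t i) = (s i).@[fun j => e`_(n + j)].
  have /choice [t tP] : forall i, exists t, GRing.rterm t /\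
      forall e : seq K, GRing.eval e t = (s i).@[fun j => e`_(n + j)].
    by move=> i; have [t rt tE] := mpoly_term n (s i); exists t.
  by exists t.
(* The variables of index less than n stand for y, the next m ones for v. *)
pose eqs (r : seq 'I_n) : GRing.formula K :=
  foldr (fun (i : 'I_n) f => GRing.And (GRing.Equal (GRing.Var K i) (t i)) f)
    (GRing.Bool true) r.
have eqsP r e : GRing.holds e (eqs r) <->
    forall i : 'I_n, i \in r -> e`_i = GRing.eval e (t i).
  elim: r => [|i r [IH1 IH2]] /=; first by split.
  split=> [[ei /IH1 er] j|er]; first by rewrite inE => /predU1P [->|/er].
  split; first by apply: er; rewrite mem_head.
  by apply: IH2 => j jr; apply: er; rewrite inE jr orbT.
have eqs_rf r : GRing.rformula (eqs r).
  by elim: r => //= i r ->; rewrite (tP i).1.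
pose phi := foldr GRing.Exists (eqs (enum 'I_n)) (iota n m).
have phi_rf : GRing.rformula phi by rewrite /phi; elim: (iota n m) => //=.
have F_closed := @GRing.solve_monicpoly K.
pose psi := GRing.quantifier_elim (@ClosedFieldQE.ex_elim K) phi.
have /andP [psi_qf psi_rf] : GRing.qf_form psi && GRing.rformula psi.
  by apply: GRing.quantifier_elim_wf phi_rf; apply: ClosedFieldQE.wf_ex_elim.
have psiP e : reflect (GRing.holds e phi) (GRing.qf_eval e psi).
  apply: GRing.quantifier_elim_rformP phi_rf; first exact: ClosedFieldQE.wf_ex_elim.
  exact: ClosedFieldQE.holds_ex_elim.
have [cs csE] := @dnf_mpoly n _ (GRing.qf_to_dnf_rterm false psi_rf).
exists cs => y; rewrite -csE GRing.qf_to_dnfP ?psi_qf //.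
set e := [seq y i | i <- enum 'I_n].
have ey (i : 'I_n) : e`_i = y i.
  by rewrite (nth_map i) ?size_enum_ord // nth_ord_enum.
split=> [[v yv]|/psiP /GRing.foldExistsP [e' ee' /eqsP e'E]].
  apply/psiP/GRing.foldExistsP; exists (e ++ [seq v j | j <- enum 'I_m]).
    move=> i; rewrite inE /= mem_iota negb_and -!leqNgt -ltnNge.
    have se : size e = n by rewrite size_map size_enum_ord.
    have sv : size [seq v j | j <- enum 'I_m] = m by rewrite size_map size_enum_ord.
    rewrite nth_cat se; case: ltnP => //= ni nmi.
    by rewrite !nth_default ?se ?sv ?leq_subRL.
  apply/eqsP => i _; rewrite (tP i).2 nth_cat size_map size_enum_ord ltn_ord ey yv.
  apply: meval_eq => j; rewrite nth_cat size_map size_enum_ord ltnNge leq_addr /= addKn.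
  by rewrite (nth_map j) ?size_enum_ord // nth_ord_enum.
exists (fun j => e'`_(n + j)) => i.
rewrite -(tP i).2 -e'E ?mem_enum // -ey; apply: ee'.
by rewrite inE /= mem_iota negb_and -ltnNge ltn_ord.
Qed.

(** The source is irreducible, so one of the finitely many locally closed pieces
    of the image is dense in it: that piece is open in the closure. *)
Lemma image_contains_open n m (s : 'I_n -> {mpoly K[m]}) :
  exists c, [/\ forall p y, p \in c.1 -> in_image s y -> p.@[y] = 0,
    forall q, q \in c.2 -> exists2 y, in_image s y & q.@[y] != 0 &
    forall y, in_piece c y -> in_image s y].
Proof.
have [cs csP] := image_constructible s.
pose t := [tuple s i | i < n].
have tE p v : (p \mPo t).@[v] = p.@[fun i => (s i).@[v]].
  by rewrite comp_mpoly_meval; apply: meval_eq => i; rewrite tnth_mktuple.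
have im v : in_image s (fun i => (s i).@[v]) by exists v.
apply: contrapT => no.
(* A piece with an equation that does not hold on the whole image is left where
   this equation fails, and one with an inequation that holds nowhere on the
   image does not meet it. If these were all the pieces, a point where all
   these equations fail would lie in none of them. *)
have [qs [qsn qsP]] : exists qs : seq {mpoly K[m]},
    (forall q, q \in qs -> exists v, q.@[v] != 0) /\
    forall v, (forall q, q \in qs -> q.@[v] != 0) ->
      ~~ has (fun c => in_piece c (fun i => (s i).@[v])) cs.
  have : {subset cs <= cs} by [].
  elim: {-2}cs => [_|c cs' IHcs sub]; first by exists [::].
  have [|qs [qsn qsP]] := IHcs; first by move=> c' c'cs; apply: sub; rewrite inE c'cs orbT.
  have [[p [pc [v pv]]]|nop] :=
      pselect (exists p, p \in c.1 /\ exists v, p.@[fun i => (s i).@[v]] != 0).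
    exists ((p \mPo t) :: qs); split=> [q|w qw].
      by rewrite inE => /predU1P [->|/qsn //]; exists v; rewrite tE.
    rewrite /= negb_or qsP ?andbT; last by move=> q qqs; apply: qw; rewrite inE qqs orbT.
    have := qw _ (mem_head _ _); rewrite tE; apply: contra => /andP [/allP /(_ _ pc) //].
  have [[q [qc q0]]|noq] :=
      pselect (exists q, q \in c.2 /\ forall v, q.@[fun i => (s i).@[v]] = 0).
    exists qs; split=> // w qw; rewrite /= negb_or qsP // andbT.
    by apply/negP => /andP [_ /allP /(_ _ qc)]; rewrite q0 eqxx.
  case: no; exists c; split=> [p y pc [v yv]|q qc|y yc].
  - apply/eqP/negP => /negP py; apply: nop; exists p; split=> //; exists v.
    by rewrite -(meval_eq _ yv).
  - apply: contrapT => no; apply: noq; exists q; split=> // v.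
    by apply/eqP/negP => /negP qv; apply: no; exists (fun i => (s i).@[v]).
  by apply/csP/hasP; exists c => //; apply: sub; rewrite mem_head.
have [v v0] := nonvanishing_prod qsn.
have qv q : q \in qs -> q.@[v] != 0.
  move=> qqs; apply: contraNneq v0 => qv.
  by rewrite (big_rem q) //= mevalM qv mul0r.
by have /negP := qsP v qv; apply; apply/csP.
Qed.

(** The images have the same closure. The part of the second one outside the
    hypersurface p0 = 0 meets every nonempty open subset of that closure, in
    particular the one contained in the first image. *)
Lemma common_value n m m' (s : 'I_n -> {mpoly K[m]}) (s' : 'I_n -> {mpoly K[m']})
    (p0 : {mpoly K[n]}) :
  (forall p, (exists2 y, in_image s y & p.@[y] != 0) <->
             (exists2 y, in_image s' y & p.@[y] != 0)) ->
  (exists2 y, in_image s y & p0.@[y] != 0) ->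
  exists y, [/\ in_image s y, in_image s' y & p0.@[y] != 0].
Proof.
move=> ss' [y0 iy0 p0y0].
have [c [c1 c2 cim]] := image_contains_open s.
have [y iy hy] : exists2 y, in_image s y & (\prod_(q <- p0 :: c.2) q).@[y] != 0.
  pose t := [tuple s i | i < n].
  have tE p v : (p \mPo t).@[v] = p.@[fun i => (s i).@[v]].
    by rewrite comp_mpoly_meval; apply: meval_eq => i; rewrite tnth_mktuple.
  have [|v] := @nonvanishing_prod K m [seq q \mPo t | q <- p0 :: c.2].
    move=> _ /mapP [q qs ->].
    have [y [v yv] qy] : exists2 y, in_image s y & q.@[y] != 0.
      by move: qs; rewrite inE => /predU1P [->|/c2 //]; exists y0.
    by exists v; rewrite tE -(meval_eq _ yv).
  rewrite big_map -(big_morph _ (rmorphM _) (rmorph1 _)) tE => v0.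
  by exists (fun i => (s i).@[v]) => //; exists v.
have [y' iy' hy'] : exists2 y, in_image s' y & (\prod_(q <- p0 :: c.2) q).@[y] != 0.
  by apply/ss'; exists y.
have qy' q : q \in p0 :: c.2 -> q.@[y'] != 0.
  by move=> qs; apply: contraNneq hy' => q0; rewrite (big_rem q) //= mevalM q0 mul0r.
exists y'; split=> //; last by apply: qy'; rewrite mem_head.
apply: cim; apply/andP; split; apply/allP => p pc; last first.
  by apply: qy'; rewrite inE pc orbT.
apply/negP => /negP py'.
have [y1 iy1] : exists2 y, in_image s y & p.@[y] != 0 by apply/ss'; exists y'.
by rewrite (c1 p) ?eqxx.
Qed.

End Elimination.

(** * Structure determinants as polynomial functions *)

Section PolynomialFun.
Variables (K : fieldType) (m : nat).

Definition polynomial_fun (f : ('I_m -> K) -> K) : Prop :=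
  exists p : {mpoly K[m]}, forall v, f v = p.@[v].

Lemma polynomial_fun_const c : polynomial_fun (fun=> c).
Proof. by exists c%:MP => v; rewrite mevalC. Qed.

Lemma polynomial_fun_var i : polynomial_fun (fun v => v i).
Proof. by exists 'X_i => v; rewrite mevalXU. Qed.

Lemma polynomial_funM f g :
  polynomial_fun f -> polynomial_fun g -> polynomial_fun (fun v => f v * g v).
Proof. by move=> [p pE] [q qE]; exists (p * q) => v; rewrite mevalM pE qE. Qed.

Lemma polynomial_funB f g :
  polynomial_fun f -> polynomial_fun g -> polynomial_fun (fun v => f v - g v).
Proof. by move=> [p pE] [q qE]; exists (p - q) => v; rewrite mevalB pE qE. Qed.

Lemma polynomial_fun_sum (I : finType) (f : I -> ('I_m -> K) -> K) :
  (forall i, polynomial_fun (f i)) -> polynomial_fun (fun v => \sum_i f i v).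
Proof.
move=> /choice [p pE]; exists (\sum_i p i) => v.
by rewrite rmorph_sum; apply: eq_bigr => i _; apply: pE.
Qed.

Lemma polynomial_fun_prod (I : finType) (f : I -> ('I_m -> K) -> K) :
  (forall i, polynomial_fun (f i)) -> polynomial_fun (fun v => \prod_i f i v).
Proof.
move=> /choice [p pE]; exists (\prod_i p i) => v.
by rewrite rmorph_prod; apply: eq_bigr => i _; apply: pE.
Qed.

Lemma polynomial_fun_det n (M : ('I_m -> K) -> 'M[K]_n) :
  (forall i j, polynomial_fun (fun v => M v i j)) -> polynomial_fun (fun v => \det (M v)).
Proof.
move=> MP; apply: polynomial_fun_sum => s; apply: polynomial_funM.
  exact: polynomial_fun_const.
by apply: polynomial_fun_prod => i; apply: MP.
Qed.

End PolynomialFun.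

Lemma polynomial_fun_comp (K : fieldType) m m' (f : ('I_m -> K) -> K) (r : 'I_m -> 'I_m') :
  polynomial_fun f -> polynomial_fun (fun v => f (fun i => v (r i))).
Proof.
case=> p pE; exists (p \mPo [tuple 'X_(r i) | i < m]) => v.
rewrite comp_mpoly_meval pE; apply: meval_eq => i.
by rewrite tnth_mktuple mevalXU.
Qed.

Section GenericVectors.
Variables (K : fieldType) (Omega : signature) (G : semigroupType).
Variable deg0 : Omega 0%N -> G.
Variables (A : fd_graded_alg K deg0) (n : nat) (e : n.-tuple A) (d : 'I_n -> G).
Hypothesis ed : homogeneous_basis e d.
Local Notation place := (option (sc_place deg0 d)).

(* Some (i, j) is the entry of a matrix that gives the coordinate of number j
   of the vector of number i; None is the scaling factor of the cone below. *)
Local Notation m := #|{: option ('I_n * 'I_n)}|.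

Definition generic_vector (v : 'I_m -> K) (i : 'I_n) : A :=
  \sum_j (if d j == d i then v (enum_rank (Some (i, j))) else 0) *: tnth e j.

Lemma generic_vector_degree v i : generic_vector v i \in ga_comp A (d i).
Proof.
apply: rpred_sum => j _; case: eqP => [<-|_]; last by rewrite scale0r mem0v.
by apply: rpredZ; apply: ed.2.
Qed.

Lemma generic_vector_surj (mu : K) (x : 'I_n -> A) :
  (forall i, x i \in ga_comp A (d i)) ->
  exists v, v (enum_rank None) = mu /\ generic_vector v = x.
Proof.
move=> xd; exists (fun k => if enum_val k is Some p then coord e p.2 (x p.1) else mu).
split; first by rewrite enum_rankK.
apply: funext => i; rewrite [RHS](coord_sum ed); apply: eq_bigr => j _.
case: eqP => [_|/eqP dj]; first by rewrite enum_rankK.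
by rewrite (coord_comp ed (xd i) dj).
Qed.

(** Expand the operation by multilinearity. *)
Lemma sc_det_polynomial (k : place) :
  polynomial_fun (fun v => sc_det e k (generic_vector v)).
Proof.
have cP i j : polynomial_fun (fun v : 'I_m -> K =>
    if d j == d i then v (enum_rank (Some (i, j))) else 0).
  by case: eqP => _; [apply: polynomial_fun_var | apply: polynomial_fun_const].
apply: polynomial_fun_det => i j; under eq_fun do rewrite mxE.
have xP i' : polynomial_fun (fun v => coord e j (generic_vector v i')).
  by under eq_fun do rewrite (coord_sumE ed); apply: cP.
case: k => [p|] //=; case: eqP => // _.
pose c l k v : K := if d k == d (sc_arg p l)
  then v (enum_rank (Some (sc_arg p l, k)) : 'I_m) else 0.
pose val (q : {ffun 'I_(sc_arity p) -> 'I_n}) :=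
  coord e j (omega_op (ga_str A) (sc_op p) [ffun l => tnth e (q l)]).
rewrite (_ : (fun v => _) = fun v =>
    \sum_(q : {ffun 'I_(sc_arity p) -> 'I_n}) (\prod_l c l (q l) v) * val q).
  apply: polynomial_fun_sum => q; apply: polynomial_funM.
    by apply: polynomial_fun_prod => l; apply: cP.
  exact: polynomial_fun_const.
apply: funext => v.
rewrite (multilinear_expand (omega_opP (ga_str A) (sc_op p))
  (fun l k => c l k v *: tnth e k) [ffun l => sc_arg p l]).
rewrite linear_sum /=; apply: eq_bigr => q _.
transitivity (coord e j ((\prod_l c l (q l) v) *:
    omega_op (ga_str A) (sc_op p) [ffun l => tnth e (q l)])); last by rewrite linearZ.
congr (coord e j _).
rewrite -(multilinear_scale (omega_opP (ga_str A) (sc_op p))).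
by congr (omega_op _ _ _); apply/ffunP => l; rewrite !ffunE.
Qed.

End GenericVectors.

(** * Comparing structure constants *)

Section Cone.
Variables (K : closedFieldType) (Omega : signature) (G : semigroupType).
Variable deg0 : Omega 0%N -> G.
Variables A B : fd_graded_alg K deg0.
Variables (n : nat) (e : n.-tuple A) (e' : n.-tuple B) (d : 'I_n -> G).
Hypotheses (ed : homogeneous_basis e d) (e'd : homogeneous_basis e' d).
Hypothesis primeA : graded_prime A.
Hypothesis idBA : forall f : graded_poly K Omega G,
  graded_identity B f -> graded_identity A f.
Local Notation place := (option (sc_place deg0 d)).

(** On a cone over an infinite field a polynomial vanishes if and only if its
    homogeneous components do, and the transfer applies to these. *)
Lemma transfer_cone L (ks : 'I_L -> place) (p : {mpoly K[L]}) (mu : K) (x : 'I_n -> A) :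
  (forall i, x i \in ga_comp A (d i)) ->
  p.@[fun k => mu * sc_det e (ks k) x] != 0 ->
  exists nu (y : 'I_n -> B), (forall i, y i \in ga_comp B (d i)) /\
    p.@[fun k => nu * sc_det e' (ks k) y] != 0.
Proof.
move=> xd px.
pose Q (s : 'I_L -> K) : {poly K} :=
  \sum_(m <- msupp p) (p@_m * \prod_k s k ^+ m k) *: 'X^(mdeg m).
have QE s nu : (Q s).[nu] = p.@[fun k => nu * s k].
  rewrite mevalE horner_sum; apply: eq_bigr => m _.
  rewrite hornerZ hornerXn -mulrA; congr (_ * _).
  under [RHS]eq_bigr do rewrite exprMn.
  by rewrite big_split /= prodrXr mdegE mulrC.
have Qc s N : (Q s)`_N = \sum_(m <- msupp p | mdeg m == N) p@_m * \prod_k s k ^+ m k.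
  rewrite coef_sum [RHS]big_mkcond; apply: eq_bigr => m _.
  by rewrite coefZ coefXn eq_sym; case: eqP => _; rewrite ?mulr1 ?mulr0.
(* The monomial m as a product of mdeg m determinants. *)
pose l (m : 'X_{1..L}) := flatten [seq nseq (m k) (ks k) | k <- enum 'I_L].
have prodl (C : fd_graded_alg K deg0) (b : n.-tuple C) z m :
    \prod_(k <- l m) sc_det b k z = \prod_k sc_det b (ks k) z ^+ m k.
  rewrite big_flatten big_map big_enum; apply: eq_bigr => k _.
  by rewrite big_nseq iter_mulr_1.
have sizel m : size (l m) = mdeg m.
  rewrite size_flatten /shape -map_comp sumnE big_map big_enum mdegE.
  by apply: eq_bigr => k _; rewrite /= size_nseq.
have [N QN] : exists N, (Q (fun k => sc_det e (ks k) x))`_N != 0.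
  apply: contrapT => no; move/negP: px; apply; rewrite -QE.
  rewrite (_ : Q _ = 0) ?horner0 //; apply/polyP => N; rewrite coef0.
  by apply/eqP/negP => /negP QN; apply: no; exists N.
rewrite Qc -big_filter in QN.
have [||y yd yN] := transfer_det (e := e) (l := l) (N := N) (c := fun m => p@_m)
    (r := [seq m <- msupp p | mdeg m == N]) ed primeA idBA e'd _ xd.
- by move=> m; rewrite mem_filter sizel => /andP [/eqP].
- by under eq_bigr do rewrite prodl.
have Qy : Q (fun k => sc_det e' (ks k) y) != 0.
  apply: contraNneq yN => Q0; under eq_bigr do rewrite prodl.
  by rewrite big_filter -Qc Q0 coef0.
have /closed_nonrootP [nu] := Qy; rewrite /root QE => pnu.
by exists nu, y.
Qed.

End Cone.

Lemma In_tnth (T : Type) (s : seq T) (k : T) :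
  List.In k s -> exists i, tnth (in_tuple s) i = k.
Proof.
elim: s => //= a s IHs [->|/IHs [i <-]]; first by exists ord0.
by exists (lift ord0 i); rewrite !(tnth_nth a) /=.
Qed.

Section Comparison.
Variables (K : closedFieldType) (Omega : signature) (G : semigroupType).
Variable deg0 : Omega 0%N -> G.
Variables A B : fd_graded_alg K deg0.
Variables (n : nat) (e : n.-tuple A) (e' : n.-tuple B) (d : 'I_n -> G).
Hypotheses (ed : homogeneous_basis e d) (e'd : homogeneous_basis e' d).
Hypotheses (primeA : graded_prime A) (primeB : graded_prime B).
Hypothesis idAB : forall f : graded_poly K Omega G,
  graded_identity A f <-> graded_identity B f.
Local Notation place := (option (sc_place deg0 d)).
Local Notation m := #|{: option ('I_n * 'I_n)}|.

(** For finitely many structure constants the two cones have the same closure,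
    and a common point yields the equations; finitely many structure constants
    suffice by the basis theorem. *)
Lemma common_structure_constants :
  exists (x : 'I_n -> A) (y : 'I_n -> B),
    [/\ forall i, x i \in ga_comp A (d i), forall i, y i \in ga_comp B (d i),
        coord_det e x != 0, coord_det e' y != 0 &
        forall k : place, sc_det e k x / coord_det e x = sc_det e' k y / coord_det e' y].
Proof.
have [pA pAE] := choice (sc_det_polynomial ed).
have [pB pBE] := choice (sc_det_polynomial e'd).
pose uA (v : 'I_(m + m) -> K) (i : 'I_m) := v (lshift m i).
pose uB (v : 'I_(m + m) -> K) (i : 'I_m) := v (rshift m i).
(* The equality of the structure constants of number k, without denominators. *)
have : forall k : place, polynomial_fun (fun v =>
    sc_det e k (generic_vector e d (uA v)) *
      sc_det e' (None : place) (generic_vector e' d (uB v)) -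
    sc_det e' k (generic_vector e' d (uB v)) *
      sc_det e (None : place) (generic_vector e d (uA v))).
  move=> k.
  have pfA k' := polynomial_fun_comp (@lshift m m) (sc_det_polynomial ed k').
  have pfB k' := polynomial_fun_comp (@rshift m m) (sc_det_polynomial e'd k').
  exact: (polynomial_funB (polynomial_funM (pfA k) (pfB None))
                          (polynomial_funM (pfB k) (pfA None))).
move=> /choice [F FE]; have [ks ksP] := zeros_finite F.
pose kt := in_tuple (None :: ks).
pose L := size (None :: ks).
pose s (i : 'I_L) : {mpoly K[m]} := 'X_(enum_rank None) * pA (tnth kt i).
pose s' (i : 'I_L) : {mpoly K[m]} := 'X_(enum_rank None) * pB (tnth kt i).
have sE v : (fun i => (s i).@[v]) =
    fun i => v (enum_rank None) * sc_det e (tnth kt i) (generic_vector e d v).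
  by apply: funext => i; rewrite mevalM mevalXU pAE.
have s'E v : (fun i => (s' i).@[v]) =
    fun i => v (enum_rank None) * sc_det e' (tnth kt i) (generic_vector e' d v).
  by apply: funext => i; rewrite mevalM mevalXU pBE.
have [||y [[v1 yv1] [v2 yv2] y0]] := @common_value K L m m s s' 'X_ord0.
- move=> p; split=> [[y [v yv]]|[y [v yv]]].
    rewrite (meval_eq _ yv) sE => pv.
    have [nu [z [zd pz]]] := transfer_cone ed e'd primeA (fun f => (idAB f).2)
      (generic_vector_degree ed v) pv.
    have [v' [v'nu v'z]] := generic_vector_surj e'd nu zd.
    by exists (fun i => (s' i).@[v']); [exists v' | rewrite s'E v'nu v'z].
  rewrite (meval_eq _ yv) s'E => pv.
  have [nu [z [zd pz]]] := transfer_cone e'd ed primeB (fun f => (idAB f).1)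
    (generic_vector_degree e'd v) pv.
  have [v' [v'nu v'z]] := generic_vector_surj ed nu zd.
  by exists (fun i => (s i).@[v']); [exists v' | rewrite sE v'nu v'z].
- have [v [v1 ve]] := generic_vector_surj ed 1 ed.2.
  exists (fun i => (s i).@[v]); first by exists v.
  rewrite mevalXU (congr1 (fun f => f ord0) (sE v)) v1 ve mul1r (tnth_nth None) /=.
  by rewrite /sc_det /= (coord_det_basis ed) oner_eq0.
pose x := generic_vector e d v1; pose z := generic_vector e' d v2.
pose mu1 := v1 (enum_rank None); pose mu2 := v2 (enum_rank None).
have yE k : List.In k (None :: ks) -> mu1 * sc_det e k x = mu2 * sc_det e' k z.
  move=> kks; have [j kE] := In_tnth kks; have := yv1 j.
  rewrite (congr1 (fun f => f j) (sE v1)) kE => <-.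
  by rewrite yv2 (congr1 (fun f => f j) (s'E v2)) kE.
have yE0 : mu1 * coord_det e x = mu2 * coord_det e' z by apply: (yE None); left.
have : mu1 * coord_det e x != 0.
  move: y0; rewrite mevalXU yv1 (congr1 (fun f => f ord0) (sE v1)).
  by rewrite (tnth_nth (None : place)).
move=> nz; have [mu1n xn] : mu1 != 0 /\ coord_det e x != 0.
  by apply/andP; rewrite -negb_or -mulf_eq0.
have [mu2n zn] : mu2 != 0 /\ coord_det e' z != 0.
  by apply/andP; rewrite -negb_or -mulf_eq0 -yE0.
exists x, z; split=> //; try exact: generic_vector_degree.
have cross k : List.In k (None :: ks) ->
    sc_det e k x * coord_det e' z = sc_det e' k z * coord_det e x.
  move=> /yE kE; apply: (mulfI mu1n); apply: (mulfI mu2n).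
  by rewrite [X in mu2 * X = _]mulrA kE [X in _ = mu2 * X]mulrCA yE0 -mulrA
             [X in mu2 * X = _]mulrCA.
pose v i := match split i with inl j => v1 j | inr j => v2 j end.
have vA : uA v = v1 by apply: funext => i; rewrite /uA /v (unsplitK (inl i)).
have vB : uB v = v2 by apply: funext => i; rewrite /uB /v (unsplitK (inr i)).
have Fv : forall k, (F k).@[v] = 0.
  apply: ksP => k kks; rewrite -FE vA vB.
  by apply/eqP; rewrite subr_eq0; apply/eqP/cross; right.
move=> k; have := Fv k; rewrite -FE vA vB.
move=> /eqP; rewrite subr_eq0 => /eqP kE.
by apply/eqP; rewrite eqr_div // kE.
Qed.

End Comparison.
(** * Isomorphism from equal structure constants *)

Section Cramer.
Variables (K : fieldType) (Omega : signature) (G : semigroupType).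
Variable deg0 : Omega 0%N -> G.
Variables (A : fd_graded_alg K deg0) (n : nat) (e : n.-tuple A) (d : 'I_n -> G).
Hypothesis ed : homogeneous_basis e d.
Variable x : 'I_n -> A.
Hypothesis xd : forall i, x i \in ga_comp A (d i).
Hypothesis detx : coord_det e x != 0.

(** The numerators are expanded along the row of number l, which yields the
    product of the coordinates of u with the adjugate matrix. *)
Lemma cramer_sum u : u = \sum_l
  (coord_det e (fun i => if i == l then u else x i) / coord_det e x) *: x l.
Proof.
pose M : 'M[K]_n := \matrix_(i, j) coord e j (x i).
have detl l : coord_det e (fun i => if i == l then u else x i) =
    \sum_j coord e j u * \adj M j l.
  rewrite /coord_det (expand_det_row _ l); apply: eq_bigr => j _.
  rewrite !mxE eqxx; congr (_ * (_ * \det _)); apply/matrixP => i k.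
  by rewrite !mxE eq_sym (negPf (neq_lift _ _)).
apply: (coord_inj ed) => j; rewrite linear_sum /=; apply: (mulfI detx).
transitivity (\sum_k coord e k u * (\adj M *m M) k j).
  rewrite mul_adj_mx (bigD1 j) //= big1 ?addr0 => [|k /negPf kj].
    by rewrite mxE eqxx mulr1n mulrC.
  by rewrite mxE kj mulr0n mulr0.
transitivity (\sum_l (\sum_k coord e k u * \adj M k l) * M l j).
  under eq_bigr do rewrite mxE mulr_sumr.
  rewrite exchange_big; apply: eq_bigr => l _ /=; rewrite mulr_suml.
  by apply: eq_bigr => k _; rewrite mulrA.
rewrite mulr_sumr; apply: eq_bigr => l _.
by rewrite linearZ /= -detl mxE mulrA mulrCA divff // mulr1.
Qed.

Lemma cramer_sum_degree g u : u \in ga_comp A g -> u = \sum_(l | d l == g)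
  (coord_det e (fun i => if i == l then u else x i) / coord_det e x) *: x l.
Proof.
move=> ug; rewrite -[LHS](hproj_id ed ug) [in LHS](cramer_sum u) linear_sum /=.
rewrite [RHS]big_mkcond; apply: eq_bigr => l _; rewrite linearZ /=.
case: eqP => [<-|/eqP dl]; first by rewrite hproj_id.
by rewrite (hproj_other ed (xd l) dl) scaler0.
Qed.

Lemma coord_det_homogeneous_basis : homogeneous_basis [tuple x i | i < n] d.
Proof.
split=> [|i]; last by rewrite tnth_mktuple.
rewrite basisEdim size_tuple (vector.size_basis ed.1) leqnn andbT.
apply/subvP => u _; rewrite (cramer_sum u); apply: rpred_sum => l _.
by apply/rpredZ/memv_span/tnthP; exists l; rewrite tnth_mktuple.
Qed.

End Cramer.

Section BasisMap.
Variables (K : fieldType) (Omega : signature) (G : semigroupType).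
Variable deg0 : Omega 0%N -> G.
Variables (A B : fd_graded_alg K deg0) (n : nat) (d : 'I_n -> G).

Lemma basis_map_exists (e : n.-tuple A) (e' : n.-tuple B) :
  homogeneous_basis e d -> homogeneous_basis e' d ->
  exists phi : {linear A -> B}, [/\ forall i, phi (tnth e i) = tnth e' i, bijective phi
    & forall g a, a \in ga_comp A g -> phi a \in ga_comp B g].
Proof.
move=> ed e'd.
have basis_map (C D : fd_graded_alg K deg0) (b : n.-tuple C) (b' : n.-tuple D) :
    homogeneous_basis b d ->
    exists phi : {linear C -> D}, (forall i, phi (tnth b i) = tnth b' i) /\
      forall a, phi a = \sum_i coord b i a *: tnth b' i.
  move=> bd.
  have lin : linear (fun a => \sum_i coord b i a *: tnth b' i).
    move=> c u v; rewrite scaler_sumr -big_split; apply: eq_bigr => i _ /=.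
    by rewrite linearP scalerDl scalerA.
  have [phi phiE] := ex_linfun lin; exists phi; split=> //= i.
  rewrite phiE (bigD1 i) //= big1 ?addr0 => [|j /negPf ji].
    by rewrite (coord_tnth bd) eqxx scale1r.
  by rewrite (coord_tnth bd) ji scale0r.
have [phi [phie phiE]] := basis_map A B e e' ed.
have [psi [psie psiE]] := basis_map B A e' e e'd.
exists phi; split=> // [|g a ag].
  exists psi => a; [rewrite phiE [RHS](coord_sum ed)|rewrite psiE [RHS](coord_sum e'd)];
    rewrite linear_sum; apply: eq_bigr => i _ /=; rewrite linearZ /=.
  - by rewrite psie.
  by rewrite phie.
apply/(compP e'd) => i dig.
by rewrite phiE (coord_sumE e'd) (coord_comp ed ag dig).
Qed.

Lemma equal_constants_isomorphic (e : n.-tuple A) (e' : n.-tuple B)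
    (x : 'I_n -> A) (y : 'I_n -> B) :
  homogeneous_basis e d -> homogeneous_basis e' d ->
  (forall i, x i \in ga_comp A (d i)) -> (forall i, y i \in ga_comp B (d i)) ->
  coord_det e x != 0 -> coord_det e' y != 0 ->
  (forall k : option (sc_place deg0 d),
     sc_det e k x / coord_det e x = sc_det e' k y / coord_det e' y) ->
  graded_isomorphic A B.
Proof.
move=> ed e'd xd yd detx dety xy.
have bas_x := coord_det_homogeneous_basis ed xd detx.
have bas_y := coord_det_homogeneous_basis e'd yd dety.
have [phi [phix phibij phigr]] := basis_map_exists bas_x bas_y.
have {}phix i : phi (x i) = y i by have := phix i; rewrite !tnth_mktuple.
exists phi; split=> //; apply: (hom_span (b := x)) => [a|m w u].
  exists [seq (coord [tuple x i | i < n] i a, i) | i <- enum 'I_n].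
  rewrite big_map big_enum {1}(coord_sum bas_x a); apply: eq_bigr => i _ /=.
  by rewrite tnth_mktuple.
under [in RHS]eq_ffun do rewrite phix.
have degA := op_degree_mem w (c := fun i => d (u i))
  (a := [ffun i => x (u i)] : {ffun 'I_m -> A}).
have degB := op_degree_mem w (c := fun i => d (u i))
  (a := [ffun i => y (u i)] : {ffun 'I_m -> B}).
rewrite (cramer_sum_degree ed xd detx (degA _)) => [|i]; last by rewrite ffunE.
rewrite [RHS](cramer_sum_degree e'd yd dety (degB _)) => [|i]; last by rewrite ffunE.
rewrite linear_sum; apply: eq_bigr => l /eqP dl /=; rewrite linearZ /= phix.
congr (_ *: _).
have deg_l : op_degree deg0 w (fun j => d ([ffun i => u i] j)) = d l.
  by rewrite dl; congr (op_degree _ _); apply: funext => j; rewrite ffunE.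
have := xy (Some (ScPlace deg_l)).
have argE (C : Type) (z : 'I_n -> C) :
    [ffun j => z ([ffun i => u i] j)] = [ffun i => z (u i)].
  by apply/ffunP => j; rewrite !ffunE.
by rewrite /sc_det /= !argE.
Qed.

End BasisMap.

Theorem corollary3p5 (K : closedFieldType) (Omega : signature)
    (hOmega : exists m : nat, (2 <= m)%N /\ inhabited (Omega m))
    (G : semigroupType) (deg0 : Omega 0%N -> G)
    (A B : fd_graded_alg K deg0)
    (hA : graded_prime A) (hB : graded_prime B) :
  graded_isomorphic A B <->
  (forall f : graded_poly K Omega G,
     graded_identity A f <-> graded_identity B f).
Proof.
split=> [isoAB f|idAB].
  split; apply: graded_isomorphic_identity => //.
  exact: graded_isomorphic_sym.
have [n [e [d ed]]] := homogeneous_basis_exists A.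
have [n' [e' [d' e'd']]] := homogeneous_basis_exists B.
have [y yd yfree] := transfer_free ed hA (fun f => (idAB f).2).
have [x xd xfree] := transfer_free e'd' hB (fun f => (idAB f).1).
have free_dim (V : vectType K) k (z : k.-tuple V) : free z -> (k <= \dim {:V})%N.
  by move=> /eqP; rewrite size_tuple => <-; apply: dimvS (subvf _).
have nn' : n = n'.
  have := free_dim _ _ _ yfree; have := free_dim _ _ _ xfree.
  rewrite (vector.size_basis ed.1) (vector.size_basis e'd'.1) => le1 le2.
  by apply/eqP; rewrite eqn_leq le1 le2.
have yd' : homogeneous_basis [tuple y i | i < n] d.
  split=> [|i]; last by rewrite tnth_mktuple.
  by rewrite basisEfree yfree subvf size_tuple (vector.size_basis e'd'.1) nn' leqnn.
have [u [v [ud vd du dv uv]]] := common_structure_constants ed yd' hA hB idAB.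
exact: (equal_constants_isomorphic ed yd' ud vd du dv uv).
Qed.
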